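(* Let $n\ge3$, $A=(a_1,\dots,a_n)$ positive integers, $\Pi=\prod_{i=1}^n\{0,\dots,a_i\}\subset\mathbb{Z}^n$, and let tilings and flips be as in the context. (1) For any two tilings $T,T'$ there is a sequence $T=T_0\rightsquigarrow T_1\rightsquigarrow\cdots\rightsquigarrow T_k=T'$ of tilings in which consecutive ones are related by a flip. (2) Let $\mathbb{F}$ be an ordered field and let $x_I\in\mathbb{F}$ be positive elements attached to the vertices $I$ of $T$. Define values on the vertices of $T'$ by following such a sequence and, at each flip, computing the value at the new vertex from the relation $$x_{I+e_j+e_\ell}\,x_{I+e_k}=x_I\,x_{I+e_j+e_k+e_\ell}+x_{I+e_j+e_k}\,x_{I+e_\ell}+x_{I+e_k+e_\ell}\,x_{I+e_j}$$ of the flipped cube. Then the resulting values at the vertices of $T'$ do not depend on the choice of intermediate tilings $T_1,\dots,T_{k-1}$.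
   Context: Let $C=\prod_{i=1}^n[0,a_i]$ be the cubical complex with vertex set $\Pi$. Fix $0<\theta_1<\dots<\theta_n<\pi$, $v_i=(\cos\theta_i,\sin\theta_i)$, $\pi:C\to\mathbb{R}^2$, $\pi(x)=\sum x_iv_i$, and $P=\pi(C)$. A tiling is a two-dimensional subcomplex $T\subset C$ such that $\pi|_T:T\to P$ is a homeomorphism. For $I\in\Pi$ and $j<k<\ell$ with the cube $c=\{I+xe_j+ye_k+ze_\ell: x,y,z\in[0,1]\}\subset C$, the bottom faces of $c$ are its three 2-faces containing $I+e_k$ and the top faces its three 2-faces containing $I+e_j+e_\ell$. If a tiling contains the top (resp. bottom) faces of $c$, replacing them by the bottom (resp. top) faces gives another tiling; two tilings differing in this way are related by a flip. The vertex sets then differ by exchanging one element of $\{I+e_k,I+e_j+e_\ell\}$ for the other, and the displayed relation is solved for the new vertex's value (positivity ensures no division by zero). *)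

(* Defs.v *)
From HB Require Import structures.
From mathcomp Require Import all_boot all_order all_algebra.
From mathcomp Require Import all_classical all_reals all_analysis.
Set Implicit Arguments.
Unset Strict Implicit.
Unset Printing Implicit Defensive.
Import Order.TTheory GRing.Theory Num.Theory.
Import numFieldNormedType.Exports.
Local Open Scope classical_set_scope.
Local Open Scope ring_scope.

Definition homeomorphism_on (X Y : topologicalType) (A : set X) (B : set Y)
    (f : X -> Y) : Prop :=
  set_bij A B f /\ {within A, continuous f} /\
  exists g : Y -> X,
    (forall x, A x -> g (f x) = x) /\ {within B, continuous g}.

Definition basis_vec (n : nat) (j : 'I_n) : 'rV[int]_n := delta_mx ord0 j.

(* (I, S) stands for the closed face {I + \sum_(i in S) t_i e_i | 0 <= t_i <= 1}
   of the unit cubical structure on R^n; its dimension is #|S|. *)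
Definition cell (n : nat) : Type := ('rV[int]_n * {set 'I_n})%type.

Definition vertex (n : nat) (I : 'rV[int]_n) : cell n := (I, finset.set0).

Definition dim_cell (n : nat) (c : cell n) : nat := #|c.2|.

Definition in_box (n : nat) (a : 'I_n -> nat) (c : cell n) : Prop :=
  forall i, 0 <= c.1 ord0 i /\ c.1 ord0 i + (i \in c.2)%:Z <= (a i)%:Z.

(* d = (J, S') is a face of c = (I, S) when S' is included in S, J_i = I_i for i
   outside S :\: S', and J_i is I_i or I_i + 1 for i in S :\: S'. *)
Definition face_of (n : nat) (d c : cell n) : Prop :=
  d.2 \subset c.2 /\
  forall i, c.1 ord0 i <= d.1 ord0 i <= c.1 ord0 i + (i \in c.2 :\: d.2)%:Z.

Definition cell_points (R : realType) (n : nat) (c : cell n) : set 'rV[R]_n :=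
  [set p | forall i, (c.1 ord0 i)%:~R <= p ord0 i
                       <= (c.1 ord0 i + (i \in c.2)%:Z)%:~R].

Definition subcomplex (n : nat) (a : 'I_n -> nat) (T : set (cell n)) : Prop :=
  (forall c, T c -> in_box a c) /\
  (forall c d, T c -> face_of d c -> T d).

Definition two_dimensional (n : nat) (T : set (cell n)) : Prop :=
  (forall c, T c -> (dim_cell c <= 2)%N) /\ (exists c, T c /\ dim_cell c = 2%N).

Definition realization (R : realType) (n : nat) (T : set (cell n)) :
    set 'rV[R]_n :=
  [set p | exists c, T c /\ cell_points c p].

Definition box (R : realType) (n : nat) (a : 'I_n -> nat) : set 'rV[R]_n :=
  [set p | forall i, 0 <= p ord0 i <= (a i)%:R].

Definition proj (R : realType) (n : nat) (theta : 'I_n -> R) (p : 'rV[R]_n) :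
    R * R :=
  (\sum_i p ord0 i * cos (theta i), \sum_i p ord0 i * sin (theta i)).

Definition tiling (R : realType) (n : nat) (a : 'I_n -> nat)
    (theta : 'I_n -> R) (T : set (cell n)) : Prop :=
  subcomplex a T /\ two_dimensional T /\
  homeomorphism_on (@realization R n T) (proj theta @` @box R n a) (proj theta).

Definition cube (n : nat) (I : 'rV[int]_n) (j k l : 'I_n) : cell n :=
  (I, [set j; k; l]%SET).

Definition bottom_vertex (n : nat) (I : 'rV[int]_n) (j k l : 'I_n) :=
  I + basis_vec k.

Definition top_vertex (n : nat) (I : 'rV[int]_n) (j k l : 'I_n) :=
  I + basis_vec j + basis_vec l.

(* The subcomplex generated by the 2-faces of c that contain the vertex v. *)
Definition faces_at (n : nat) (c : cell n) (v : 'rV[int]_n) : set (cell n) :=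
  [set d | exists f, [/\ face_of f c, dim_cell f = 2%N,
                         face_of (vertex v) f & face_of d f]].

(* T' is obtained from T by replacing the 2-faces of c at v by those at w.  The
   two families generate subcomplexes with the same boundary hexagon, which is
   removed with the first and put back with the second. *)
Definition replaces_faces (n : nat) (c : cell n) (v w : 'rV[int]_n)
    (T T' : set (cell n)) : Prop :=
  faces_at c v `<=` T /\ T' = (T `\` faces_at c v) `|` faces_at c w.

(* The flip T ~> T' in the cube at I in directions j < k < l, removing the
   vertex v and creating the vertex w. *)
Definition flip_in (n : nat) (a : 'I_n -> nat) (I : 'rV[int]_n) (j k l : 'I_n)
    (v w : 'rV[int]_n) (T T' : set (cell n)) : Prop :=
  [/\ (j < k < l)%N,
      in_box a (cube I j k l),
      (v = bottom_vertex I j k l /\ w = top_vertex I j k l) \/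
      (v = top_vertex I j k l /\ w = bottom_vertex I j k l) &
      replaces_faces (cube I j k l) v w T T'].

Definition flip (n : nat) (a : 'I_n -> nat) (T T' : set (cell n)) : Prop :=
  exists I j k l v w, flip_in a I j k l v w T T'.

Definition flip_sequence (R : realType) (n : nat) (a : 'I_n -> nat)
    (theta : 'I_n -> R) (T T' : set (cell n)) (m : nat)
    (s : nat -> set (cell n)) : Prop :=
  [/\ s 0%N = T, s m = T',
      forall i, (i <= m)%N -> tiling a theta (s i) &
      forall i, (i < m)%N -> flip a (s i) (s i.+1)].

(* Values are functions on all of Z^n, of which only the restriction to the
   vertices of the tiling at hand is meaningful. *)
Definition flip_values (F : realFieldType) (n : nat) (a : 'I_n -> nat)
    (T T' : set (cell n)) (x x' : 'rV[int]_n -> F) : Prop :=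
  let e := @basis_vec n in
  exists I j k l v w,
    [/\ flip_in a I j k l v w T T',
        forall J, T' (vertex J) -> J <> w -> x' J = x J &
        x' w * x v = x I * x (I + e j + e k + e l)
                     + x (I + e j + e k) * x (I + e l)
                     + x (I + e k + e l) * x (I + e j)].

Definition values_along (F : realFieldType) (n : nat) (a : 'I_n -> nat)
    (m : nat) (s : nat -> set (cell n)) (x : 'rV[int]_n -> F)
    (xs : nat -> 'rV[int]_n -> F) : Prop :=
  (forall J, s 0%N (vertex J) -> xs 0%N J = x J) /\
  (forall i, (i < m)%N -> flip_values a (s i) (s i.+1) (xs i) (xs i.+1)).

(* Main.v *)
Require Import Defs.
From HB Require Import structures.
From mathcomp Require Import all_boot all_order all_algebra.
From mathcomp Require Import all_classical all_reals all_analysis.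
From mathcomp Require Import ring lra zify.
Set Implicit Arguments.
Unset Strict Implicit.
Unset Printing Implicit Defensive.
Import Order.TTheory GRing.Theory Num.Theory.
Local Open Scope classical_set_scope.
Local Open Scope ring_scope.

(* Connectivity.  A tiling is swept by monotone lattice paths from the right
   boundary of the zonogon to the left one: a path is a word in the directions,
   and as long as the word has an ascent, some ascent j k is the right side of a
   tile of the tiling, so that the path can be pushed over this tile.  Two
   ascents that are far apart commute and two adjacent ones span a hexagon, so,
   by induction on the number of non-inversions, every tiling can be flipped
   into one containing the tiles of any prescribed sweep.  A tiling containing
   a full sweep is determined by it, because the sweep covers the zonogon.

   Independence.  It is enough to extend the values on the vertices of T to a
   positive solution X of all the cube relations on the whole box: along every
   flip sequence from T one then computes the restrictions of X.  Flipping T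
   first, we may assume that the support of every vertex of T is an interval
   whose inner coordinates are full.  For such data X is built one layer of
   the last direction at a time: two consecutive layers are related by a linear
   equation (discrete Moutard equation), whose integrability condition is the
   cube relation of the first layer, and whose solutions satisfy the cube
   relation again.  This is the 4-dimensional consistency of the cube
   recurrence. *)

Section LatticePaths.
Variable n : nat.
Implicit Types (J : 'rV[int]_n) (i j : 'I_n) (u w : seq 'I_n).
Local Notation e := (@basis_vec n).

Lemma eq_from_coord (A : Type) (U V : 'rV[A]_n) :
  (forall i, U ord0 i = V ord0 i) -> U = V.
Proof. by move=> UV; apply/rowP => i; exact: UV. Qed.

Lemma coord_add_basis J j i : (J + e j) ord0 i = J ord0 i + (i == j)%:Z.
Proof. by rewrite !mxE eqxx natz. Qed.

Lemma coord_sub_basis J j i : (J - e j) ord0 i = J ord0 i - (i == j)%:Z.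
Proof. by rewrite !mxE eqxx natz. Qed.

Lemma ord_lt_neq (j k : 'I_n) : (j < k)%N ->
  ((j == k) = false) * ((k == j) = false).
Proof. by move=> jk; rewrite -!val_eqE /= (ltn_eqF jk) (gtn_eqF jk). Qed.

Definition endpoint u : 'rV[int]_n := \sum_(j <- u) e j.

Lemma endpoint_nil : endpoint [::] = 0.
Proof. exact: big_nil. Qed.

Lemma endpoint_cons j u : endpoint (j :: u) = e j + endpoint u.
Proof. exact: big_cons. Qed.

Lemma endpoint_cat u w : endpoint (u ++ w) = endpoint u + endpoint w.
Proof. exact: big_cat. Qed.

Lemma endpoint_rcons u j : endpoint (rcons u j) = endpoint u + e j.
Proof. by rewrite -cats1 endpoint_cat endpoint_cons endpoint_nil addr0. Qed.

Lemma endpoint_perm u w : perm_eq u w -> endpoint u = endpoint w.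
Proof. exact: perm_big. Qed.

Lemma endpoint_coord u i : endpoint u ord0 i = (count_mem i u)%:Z.
Proof.
elim: u => [|j u IH]; first by rewrite endpoint_nil mxE.
by rewrite endpoint_cons addrC coord_add_basis IH /= PoszD addrC eq_sym.
Qed.

Lemma coord_add_endpoint J u i :
  (J + endpoint u) ord0 i = J ord0 i + (count_mem i u)%:Z.
Proof. by rewrite mxE endpoint_coord. Qed.

Definition word_with_counts (c : 'I_n -> nat) : seq 'I_n :=
  flatten [seq nseq (c i) i | i <- enum 'I_n].

Lemma count_word_with_counts c i : count_mem i (word_with_counts c) = c i.
Proof.
rewrite /word_with_counts count_flatten -map_comp sumnE big_map big_enum /=.
rewrite (bigD1 i) //= count_nseq /= eqxx mul1n big1 ?addn0 // => j ji.
by rewrite count_nseq /= (negbTE ji).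
Qed.

End LatticePaths.

Ltac coords i :=
  rewrite ?(coord_add_basis, coord_sub_basis) /=;
  repeat match goal with
  | |- context [(i == ?j)] => let E := fresh in
      case: (eqVneq i j) => [E|?]; [rewrite -?E ?eqxx /=|] => /=
  end.

Section IntegerBoxes.
Variable n : nat.
Implicit Types (J K : 'rV[int]_n) (lo hi : 'I_n -> int) (j k l m : 'I_n).
Local Notation e := (@basis_vec n).

Definition int_box lo hi J := forall i, lo i <= J ord0 i <= hi i.

Lemma int_box_between lo hi J J' K : int_box lo hi J -> int_box lo hi J' ->
  (forall i, J ord0 i <= K ord0 i <= J' ord0 i) -> int_box lo hi K.
Proof. by move=> B B' JKJ' i; move: (B i) (B' i) (JKJ' i); lia. Qed.

Lemma int_box_square lo hi J j k :
  int_box lo hi J -> int_box lo hi (J + e j + e k) ->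
  int_box lo hi (J + e j) /\ int_box lo hi (J + e k).
Proof.
by move=> B B'; split; apply: int_box_between B B' _ => i; coords i; lia.
Qed.

Lemma int_box_cube lo hi J j k l :
  int_box lo hi J -> int_box lo hi (J + e j + e k + e l) ->
  [/\ int_box lo hi (J + e j), int_box lo hi (J + e k) & int_box lo hi (J + e l)] /\
  [/\ int_box lo hi (J + e j + e k), int_box lo hi (J + e j + e l) &
      int_box lo hi (J + e k + e l)].
Proof.
by move=> B B'; split; split; apply: int_box_between B B' _ => i; coords i; lia.
Qed.

Lemma int_box_raise_lo lo hi m t J : lo m <= t ->
  int_box [eta lo with m |-> t] hi J <-> int_box lo hi J /\ t <= J ord0 m.
Proof.
move=> lot; split=> [B|[B tJ] i]; last by move: (B i) => /=; case: eqP => [->|_]; lia.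
split=> [i|]; last by move: (B m); rewrite /= eqxx => /andP[].
by move: (B i) => /=; case: eqP => [->|_]; lia.
Qed.

Lemma int_box_lower_hi lo hi m t J : t <= hi m ->
  int_box lo [eta hi with m |-> t] J <-> int_box lo hi J /\ J ord0 m <= t.
Proof.
move=> thi; split=> [B|[B tJ] i]; last by move: (B i) => /=; case: eqP => [->|_]; lia.
split=> [i|]; last by move: (B m); rewrite /= eqxx => /andP[].
by move: (B i) => /=; case: eqP => [->|_]; lia.
Qed.

Definition box_size lo hi := (\sum_i `|hi i - lo i|)%N.

Lemma box_size_raise_lo lo hi m : lo m < hi m ->
  (box_size [eta lo with m |-> (lo m + 1)%R] hi < box_size lo hi)%N.
Proof.
move=> lohi; rewrite /box_size (bigD1 m) //= [ltnRHS](bigD1 m) //= eqxx.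
rewrite (eq_bigr (fun i => `|hi i - lo i|%N)) => [|i /negbTE -> //].
by rewrite ltn_add2r; lia.
Qed.

Lemma box_size_lower_hi lo hi m : lo m < hi m ->
  (box_size lo [eta hi with m |-> (hi m - 1)%R] < box_size lo hi)%N.
Proof.
move=> lohi; rewrite /box_size (bigD1 m) //= [ltnRHS](bigD1 m) //= eqxx.
rewrite (eq_bigr (fun i => `|hi i - lo i|%N)) => [|i /negbTE -> //].
by rewrite ltn_add2r; lia.
Qed.

Definition last_direction lo hi m :=
  lo m < hi m /\ forall i : 'I_n, (m < i)%N -> hi i <= lo i.

Lemma last_directionP lo hi :
  (forall i, hi i <= lo i) \/ exists m, last_direction lo hi m.
Proof.
case: (pickP [pred i | lo i < hi i]) => [i0 /= lt0|none]; last first.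
  by left=> i; move: (none i) => /= /negbT; rewrite -leNgt.
right; have [m /= ltm maxm] :=
  @arg_maxnP _ i0 [pred i | lo i < hi i] (@nat_of_ord n) lt0.
exists m; split=> // i mi; rewrite leNgt; apply/negP => lti.
by move: (maxm i lti) mi; lia.
Qed.

Lemma step_le_last lo hi m J j : last_direction lo hi m ->
  int_box lo hi J -> int_box lo hi (J + e j) -> (j <= m)%N.
Proof.
move=> [_ flat] BJ BJj; rewrite leqNgt; apply/negP => /flat.
by move: (BJ j) (BJj j); rewrite coord_add_basis eqxx /=; lia.
Qed.

End IntegerBoxes.

(* A discrete Poincare lemma: maps attached to the edges of a box that commute
   around its squares have a potential. *)
Section Transport.
Variables (n : nat) (A : Type) (D : set A) (lo hi : 'I_n -> int).
Variable Phi : 'I_n -> 'rV[int]_n -> A -> A.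
Implicit Types (J : 'rV[int]_n) (j k : 'I_n) (u w : seq 'I_n) (y : A).
Local Notation e := (@basis_vec n).
Local Notation box := (int_box lo hi).

Hypothesis PhiD : forall J j y, box J -> box (J + e j) -> D y -> D (Phi j J y).
Hypothesis PhiC : forall J j k y, (j < k)%N -> box J -> box (J + e j + e k) -> D y ->
  Phi k (J + e j) (Phi j J y) = Phi j (J + e k) (Phi k J y).

Fixpoint transport J w y : A :=
  if w is j :: w' then transport (J + e j) w' (Phi j J y) else y.

Lemma transport_rcons J w j y :
  transport J (rcons w j) y = Phi j (J + endpoint w) (transport J w y).
Proof.
elim: w J y => [|k w IH] J y /=; first by rewrite endpoint_nil addr0.
by rewrite IH endpoint_cons addrA.
Qed.

Lemma box_first_step J j w : box J -> box (J + endpoint (j :: w)) -> box (J + e j).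
Proof.
move=> B B'; apply: int_box_between B B' _ => i.
by rewrite coord_add_endpoint coord_add_basis /= eq_sym; lia.
Qed.

Lemma transport_in J w y : box J -> box (J + endpoint w) -> D y -> D (transport J w y).
Proof.
elim: w J y => //= j w IH J y B B' Dy; have Bj := box_first_step B B'.
by apply: IH; rewrite // -?addrA -?endpoint_cons //; exact: PhiD.
Qed.

Lemma transport_front J u j w y : box J -> box (J + endpoint (u ++ j :: w)) -> D y ->
  transport J (u ++ j :: w) y = transport J (j :: u ++ w) y.
Proof.
elim: u J y => //= k u IH J y B B' Dy; have Bk := box_first_step B B'.
have Bkj : box (J + e k + e j).
  apply: int_box_between B B' _ => i; rewrite coord_add_endpoint /= count_cat /=.
  by rewrite !coord_add_basis ![i == _]eq_sym; lia.
rewrite IH //=; last exact: PhiD.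
  have [ejk|njk] := eqVneq j k; first by rewrite ejk.
  congr (transport _ _ _); first exact: addrAC.
  case: (ltngtP j k) => [jk|kj|/ord_inj ejk]; last by rewrite ejk eqxx in njk.
    by rewrite -PhiC // addrAC.
  exact: PhiC.
by rewrite -addrA -endpoint_cons.
Qed.

Lemma transport_perm J w w' y : perm_eq w w' -> box J -> box (J + endpoint w) -> D y ->
  transport J w y = transport J w' y.
Proof.
elim: w w' J y => [|j w IH] w' J y ww' B B' Dy.
  by move: ww'; rewrite perm_sym => /perm_nilP ->.
have /splitPr split_w' : j \in w' by rewrite -(perm_mem ww') mem_head.
case: split_w' ww' => u z ww'.
rewrite transport_front -?(endpoint_perm ww') //=; have Bj := box_first_step B B'.
apply: IH; rewrite // -?addrA -?endpoint_cons //; last exact: PhiD.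
by rewrite -(perm_cons j) (permPl ww') -cat1s perm_catCA.
Qed.

Lemma transport_potential y0 : D y0 -> exists g : 'rV[int]_n -> A,
  [/\ g (\row_i lo i) = y0, forall J, box J -> D (g J) &
      forall J j, box J -> box (J + e j) -> g (J + e j) = Phi j J (g J)].
Proof.
move=> Dy0; pose base : 'rV[int]_n := \row_i lo i.
pose word_to J := word_with_counts (fun i => absz (J ord0 i - lo i)).
have base_word J : box J -> base + endpoint (word_to J) = J.
  move=> B; apply: eq_from_coord => i.
  rewrite coord_add_endpoint count_word_with_counts mxE; case/andP: (B i) => lo_le _.
  by rewrite gez0_abs ?subr_ge0 // addrCA subrr addr0.
have base_box J : box J -> box base.
  by move=> B i; rewrite mxE lexx; case/andP: (B i) => /le_trans; exact.
exists (fun J => transport base (word_to J) y0); split.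
- case wE: (word_to base) => [//|j w].
  have := count_word_with_counts (fun i => absz (base ord0 i - lo i)) j.
  by rewrite -/(word_to base) wE /= eqxx mxE subrr.
- by move=> J B; apply: transport_in; rewrite ?base_word //; exact: base_box B.
- move=> J j B Bj; rewrite -[in Phi j J](base_word J B) -transport_rcons.
  apply: transport_perm; rewrite ?base_word //; last exact: base_box B.
  apply/allP => i _ /=; apply/eqP; rewrite -cats1 count_cat !count_word_with_counts /=.
  by rewrite coord_add_basis [j == i]eq_sym; move: (B i); case: eqP => _ /=; lia.
Qed.

End Transport.

(** * Solutions of the cube relations *)

Lemma moutard_compatible (F : fieldType)
    (z z1 z2 z3 z12 z13 z23 z123 y y3 y13 y23 y123 : F) :
  z2 != 0 -> z3 != 0 -> z13 != 0 -> z23 != 0 ->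
  z13 * z2 = z * z123 + z12 * z3 + z23 * z1 ->
  y13 * z23 = z3 * y123 + z123 * y3 + y23 * z13 ->
  let y1 := (z * y13 + z13 * y + y3 * z1) / z3 in
  let y2 := (z * y23 + z23 * y + y3 * z2) / z3 in
  let y12 := (z1 * y123 + z123 * y1 + y13 * z12) / z13 in
  y12 = (z2 * y123 + z123 * y2 + y23 * z12) / z23 /\
  y1 * z2 = z * y12 + z12 * y + y2 * z1.
Proof.
move=> n2 n3 n13 n23 Ez Ey.
have Ez13 : z13 = (z * z123 + z12 * z3 + z23 * z1) / z2 by rewrite -Ez mulfK.
have Ey13 : y13 = (z3 * y123 + z123 * y3 + y23 * z13) / z23 by rewrite -Ey mulfK.
have ns : z * z123 + z12 * z3 + z23 * z1 != 0 by rewrite -Ez mulf_neq0.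
move=> y1 y2 y12; rewrite /y12 /y2 /y1 Ey13 Ez13.
by split; field; rewrite ?n2 ?n3 ?n23 ?ns.
Qed.

Lemma moutard_transform (F : fieldType)
    (z z1 z2 z3 z12 z13 z23 z123 y y1 y2 y3 y12 y13 y23 y123 : F) :
  z2 != 0 -> z3 != 0 -> z13 != 0 -> z23 != 0 ->
  z13 * z2 = z * z123 + z12 * z3 + z23 * z1 ->
  y1 * z3 = z * y13 + z13 * y + y3 * z1 ->
  y2 * z3 = z * y23 + z23 * y + y3 * z2 ->
  y13 * z23 = z3 * y123 + z123 * y3 + y23 * z13 ->
  y12 * z13 = z1 * y123 + z123 * y1 + y13 * z12 ->
  y13 * y2 = y * y123 + y12 * y3 + y23 * y1.
Proof.
move=> n2 n3 n13 n23 Ez E1 E2 E13 E12.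
have -> : y12 = (z1 * y123 + z123 * y1 + y13 * z12) / z13 by rewrite -E12 mulfK.
have -> : y1 = (z * y13 + z13 * y + y3 * z1) / z3 by rewrite -E1 mulfK.
have -> : y2 = (z * y23 + z23 * y + y3 * z2) / z3 by rewrite -E2 mulfK.
have -> : y13 = (z3 * y123 + z123 * y3 + y23 * z13) / z23 by rewrite -E13 mulfK.
have ns : z * z123 + z12 * z3 + z23 * z1 != 0 by rewrite -Ez mulf_neq0.
have -> : z13 = (z * z123 + z12 * z3 + z23 * z1) / z2 by rewrite -Ez mulfK.
by field; rewrite ?n2 ?n3 ?n23 ?ns.
Qed.

Section CubeRelations.
Variables (F : realFieldType) (n : nat).
Implicit Types (J K : 'rV[int]_n) (lo hi : 'I_n -> int) (j k l m : 'I_n).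
Implicit Types (X Y Z f g : 'rV[int]_n -> F) (t : int) (y : F).
Local Notation e := (@basis_vec n).

Definition hexagon_sum X J j k l :=
  X J * X (J + e j + e k + e l) + X (J + e j + e k) * X (J + e l)
  + X (J + e k + e l) * X (J + e j).

Definition cube_relation X J j k l :=
  X (top_vertex J j k l) * X (bottom_vertex J j k l) = hexagon_sum X J j k l.

Definition cube_relations_on lo hi X := forall J j k l, (j < k < l)%N ->
  int_box lo hi J -> int_box lo hi (J + e j + e k + e l) -> cube_relation X J j k l.

Definition positive_on lo hi X := forall J, int_box lo hi J -> 0 < X J.

(* The cube relation in the directions j < k < m when Z and Y are the
   restrictions of one function to two consecutive layers of direction m. *)
Definition moutard Z Y J j k :=
  Y (J + e j) * Z (J + e k) =
    Z J * Y (J + e j + e k) + Z (J + e j + e k) * Y J + Y (J + e k) * Z (J + e j).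

Definition moutard_on lo hi Z Y := forall J j k, (j < k)%N ->
  int_box lo hi J -> int_box lo hi (J + e j + e k) -> moutard Z Y J j k.

(* The Moutard equation in the directions j < m, solved for Y (J + e j). *)
Definition moutard_step Z Y m j J y :=
  (Z J * Y (J + e j + e m) + Z (J + e j + e m) * y + Y (J + e m) * Z (J + e j))
    / Z (J + e m).

Lemma moutard_step_compatible Z Y J j k m y :
  Z (J + e k) != 0 -> Z (J + e m) != 0 -> Z (J + e j + e m) != 0 ->
  Z (J + e k + e m) != 0 -> cube_relation Z J j k m -> moutard Z Y (J + e m) j k ->
  let step := moutard_step Z Y m in
  let yj := step j J y in let yk := step k J y in let yjk := step k (J + e j) yj in
  yjk = step j (J + e k) yk /\
  yj * Z (J + e k) = Z J * yjk + Z (J + e j + e k) * y + yk * Z (J + e j).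
Proof.
move=> nk nm njm nkm Zrel; rewrite /moutard ![J + e m + _]addrAC.
rewrite [J + e j + e m + e k]addrAC => Yrel.
rewrite /moutard_step [J + e k + e j]addrAC.
exact: (moutard_compatible y nk nm njm nkm Zrel Yrel).
Qed.

Definition glue m t f g J := if J ord0 m <= t then f J else g J.

Lemma glue_low m t f g J : J ord0 m <= t -> glue m t f g J = f J.
Proof. by rewrite /glue => ->. Qed.

Lemma glue_high m t f g J : t < J ord0 m -> glue m t f g J = g J.
Proof. by rewrite /glue ltNge => /negbTE ->. Qed.

Section MoutardLayer.
Variables (lo hi : 'I_n -> int) (m : 'I_n) (Z Y : 'rV[int]_n -> F).
Hypothesis lastm : last_direction lo hi m.
Hypothesis Z_gt0 : positive_on lo hi Z.
Hypothesis Z_cube : cube_relations_on lo hi Z.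
Local Notation bottom := (int_box lo [eta hi with m |-> lo m]).
Local Notation upper := (int_box [eta lo with m |-> (lo m + 1)%R] hi).
Hypothesis Y_gt0 : positive_on [eta lo with m |-> (lo m + 1)%R] hi Y.
Hypothesis Y_moutard : moutard_on [eta lo with m |-> (lo m + 1)%R] hi Z Y.

Let lt_lohi : lo m < hi m. Proof. by case: lastm. Qed.

Let bottomP J : bottom J <-> int_box lo hi J /\ J ord0 m = lo m.
Proof.
rewrite int_box_lower_hi ?(ltW lt_lohi) //; split=> -[B Jm]; split=> //.
  by move: (B m); lia.
by rewrite Jm.
Qed.

Let upperP J : upper J <-> int_box lo hi J /\ lo m < J ord0 m.
Proof. by rewrite int_box_raise_lo ?lerDl // lezD1. Qed.

Let upper_of_bottom J : bottom J -> upper (J + e m).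
Proof.
move=> /bottomP[B Jm]; apply/upperP; split.
  by move=> i; move: (B i) Jm lt_lohi; coords i; lia.
by rewrite coord_add_basis eqxx Jm /=; lia.
Qed.

Let Z_neq0 J : int_box lo hi J -> Z J != 0.
Proof. by move=> /Z_gt0; rewrite lt0r => /andP[]. Qed.

Let bottom_compatible J j k y : (j < k)%N -> bottom J -> bottom (J + e j + e k) ->
  let step := moutard_step Z Y m in
  let yj := step j J y in let yk := step k J y in let yjk := step k (J + e j) yj in
  yjk = step j (J + e k) yk /\
  yj * Z (J + e k) = Z J * yjk + Z (J + e j + e k) * y + yk * Z (J + e j).
Proof.
move=> jk B B2; have [Bj Bk] := int_box_square B B2.
have km : (k < m)%N.
  have /bottomP[BZ jm] := Bj; have /bottomP[BZ2 jkm] := B2.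
  have := step_le_last lastm BZ BZ2; rewrite leq_eqVlt => /predU1P[/ord_inj km|//].
  by move: jkm; rewrite coord_add_basis jm km eqxx /=; lia.
have inZ K : bottom K -> int_box lo hi (K + e m).
  by move=> /upper_of_bottom/upperP[].
have [[BZ _] [BZk _]] : (int_box lo hi J /\ J ord0 m = lo m) /\
  (int_box lo hi (J + e k) /\ (J + e k) ord0 m = lo m) by split; apply/bottomP.
apply: moutard_step_compatible; try exact/Z_neq0/inZ.
- exact: Z_neq0.
- by apply: Z_cube; rewrite ?jk //; exact: inZ.
- by apply: Y_moutard; rewrite // ?[J + e m + _]addrAC ?[J + e j + e m + _]addrAC;
    exact: upper_of_bottom.
Qed.

Lemma moutard_bottom_layer y : 0 < y -> exists g,
  [/\ g (\row_i lo i) = y, positive_on lo [eta hi with m |-> lo m] g &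
      forall J j, bottom J -> bottom (J + e j) ->
        g (J + e j) = moutard_step Z Y m j J (g J)].
Proof.
move=> y_gt0.
apply: (@transport_potential n F [set x : F | 0 < x] lo _ (moutard_step Z Y m)) => //=.
- move=> J j x B Bj x_gt0; have /bottomP[BZ _] := B; have /bottomP[BZj _] := Bj.
  have /upper_of_bottom Bm := B; have /upper_of_bottom Bjm := Bj.
  have /upperP[BZm _] := Bm; have /upperP[BZjm _] := Bjm.
  by rewrite /moutard_step divr_gt0 ?Z_gt0 // !addr_gt0 // mulr_gt0 ?Z_gt0 ?Y_gt0.
- by move=> J j k x jk B B2 _; case: (bottom_compatible x jk B B2).
Qed.

Lemma glue_moutard g :
  (forall J j, bottom J -> bottom (J + e j) ->
     g (J + e j) = moutard_step Z Y m j J (g J)) ->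
  moutard_on lo hi Z (glue m (lo m) g Y).
Proof.
move=> g_step J j k jk B B2; have [Bj Bk] := int_box_square B B2.
have mj : (m == j) = false.
  by case: (ord_lt_neq (leq_trans jk (step_le_last lastm Bj B2))).
rewrite /moutard; have [Jm|Jm] := ltP (lo m) (J ord0 m).
  have above i : lo m < (J + e i) ord0 m by rewrite coord_add_basis; lia.
  have above2 : lo m < (J + e j + e k) ord0 m by rewrite !coord_add_basis; lia.
  by rewrite !glue_high //; apply: Y_moutard => //; apply/upperP.
have {}Jm : J ord0 m = lo m by move: (B m); lia.
have bJ : bottom J by apply/bottomP.
have Jjm : (J + e j) ord0 m = lo m by rewrite coord_add_basis mj addr0.
have bJj : bottom (J + e j) by apply/bottomP.
have [km|km] := eqVneq m k.
  have above K : K ord0 m = lo m -> lo m < (K + e m) ord0 m.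
    by move=> Km; rewrite coord_add_basis eqxx Km /=; lia.
  rewrite -km [in RHS]glue_high ?above // glue_low ?Jjm //.
  rewrite [in RHS]glue_low ?Jm // [in RHS]glue_high ?above // g_step //.
  by rewrite /moutard_step divfK // Z_neq0 // km.
have Jkm : (J + e k) ord0 m = lo m by rewrite coord_add_basis (negbTE km) addr0.
have Jjkm : (J + e j + e k) ord0 m = lo m by rewrite coord_add_basis (negbTE km) addr0.
have bJk : bottom (J + e k) by apply/bottomP.
have bJjk : bottom (J + e j + e k) by apply/bottomP.
rewrite !glue_low ?Jjkm ?Jjm ?Jkm ?Jm // (g_step (J + e j) k) // (g_step J j) //.
by rewrite (g_step J k) //; case: (bottom_compatible (g J) jk bJ bJjk).
Qed.

End MoutardLayer.

Definition suffix_form lo hi J := forall i k : 'I_n, (i < k)%N ->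
  lo i < J ord0 i -> J ord0 k = hi k.

Definition interval_form lo hi J := forall i k l : 'I_n, (i < k < l)%N ->
  lo i < J ord0 i -> lo l < J ord0 l -> J ord0 k = hi k.

Lemma suffix_form_bottom lo hi m J : last_direction lo hi m -> int_box lo hi J ->
  suffix_form lo hi J -> J ord0 m = lo m -> J = \row_i lo i.
Proof.
move=> [ltm flat] B suf Jm; apply: eq_from_coord => i; rewrite mxE.
case: (ltngtP i m) => [im|/flat|/ord_inj -> //]; last by move: (B i); lia.
apply/eqP; rewrite eq_le andbC; case/andP: (B i) => -> _ /=.
by rewrite leNgt; apply/negP => /(suf i m im); rewrite Jm; lia.
Qed.

Lemma moutard_extension lo hi Z (y0 : 'rV[int]_n -> F) : (forall J, 0 < y0 J) ->
  positive_on lo hi Z -> cube_relations_on lo hi Z ->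
  exists Y, [/\ positive_on lo hi Y, moutard_on lo hi Z Y &
    forall J, int_box lo hi J -> suffix_form lo hi J -> Y J = y0 J].
Proof.
move=> y0_gt0; have [N] := ubnP (box_size lo hi).
elim: N lo hi => // N IH lo hi; rewrite ltnS => leN Z_gt0 Z_cube.
have [flat|[m lastm]] := last_directionP lo hi.
  exists y0; split=> // J j k _ B B2.
  by move: (flat k) (B k) (B2 k); rewrite !coord_add_basis eqxx; lia.
have [ltm flat] := lastm.
have upperP J : int_box [eta lo with m |-> (lo m + 1)%R] hi J <->
    int_box lo hi J /\ lo m < J ord0 m by rewrite int_box_raise_lo ?lerDl // lezD1.
have [||| Y [Y_gt0 Y_moutard Y_suffix]] := IH [eta lo with m |-> (lo m + 1)%R] hi.
- exact: leq_trans (box_size_raise_lo ltm) leN.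
- by move=> J /upperP[/Z_gt0].
- by move=> J j k l jkl /upperP[B _] /upperP[B3 _]; exact: Z_cube.
have [g [g_corner g_gt0 g_step]] :=
  moutard_bottom_layer lastm Z_gt0 Z_cube Y_gt0 Y_moutard (y0_gt0 (\row_i lo i)).
have bottomP J : int_box lo hi J -> J ord0 m <= lo m -> J ord0 m = lo m.
  by move=> /(_ m); lia.
exists (glue m (lo m) g Y); split.
- move=> J B; have [Jm|Jm] := leP (J ord0 m) (lo m).
    by rewrite glue_low // g_gt0 //; apply/int_box_lower_hi => //; exact: ltW.
  by rewrite glue_high // Y_gt0 //; apply/upperP.
- exact: glue_moutard.
- move=> J B suf; have [Jm|Jm] := leP (J ord0 m) (lo m).
    by rewrite glue_low // (suffix_form_bottom lastm B suf) //; exact: bottomP.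
  rewrite glue_high // Y_suffix //; first exact/upperP.
  move=> i k + /=; have [->|im] := eqVneq i m; last exact: suf.
  by move=> mk _; exact: suf mk Jm.
Qed.

Section CubeLayer.
Variables (lo hi : 'I_n -> int) (m : 'I_n) (X Y : 'rV[int]_n -> F).
Hypothesis lastm : last_direction lo hi m.
Local Notation lower := (int_box lo [eta hi with m |-> (hi m - 1)%R]).
Local Notation layer :=
  (int_box [eta lo with m |-> (hi m - 1)%R] [eta hi with m |-> (hi m - 1)%R]).
Hypothesis X_gt0 : positive_on lo [eta hi with m |-> (hi m - 1)%R] X.
Hypothesis X_cube : cube_relations_on lo [eta hi with m |-> (hi m - 1)%R] X.
Hypothesis Y_moutard : moutard_on [eta lo with m |-> (hi m - 1)%R]
  [eta hi with m |-> (hi m - 1)%R] X Y.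
Local Notation glued := (glue m (hi m - 1) X (fun J => Y (J - e m))).

Lemma lower_layerP J : lower J <-> int_box lo hi J /\ J ord0 m < hi m.
Proof. by rewrite int_box_lower_hi ?gerBl //; split=> -[B Jm]; split=> //; lia. Qed.

Lemma top_layerP J : layer J <-> int_box lo hi J /\ J ord0 m = hi m - 1.
Proof.
have [ltm _] := lastm; rewrite int_box_raise_lo; last lia.
rewrite lower_layerP; split=> [[[B Jm] Jm']|[B Jm]]; split=> //; try split=> //; lia.
Qed.

Lemma glued_top J : J ord0 m = hi m - 1 -> glued (J + e m) = Y J.
Proof. by move=> Jm; rewrite glue_high ?addrK // coord_add_basis eqxx Jm /=; lia. Qed.

Lemma glue_cube_across J j k : (j < k < m)%N -> int_box lo hi J ->
  int_box lo hi (J + e j + e k + e m) -> cube_relation glued J j k m.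
Proof.
move=> /andP[jk km] B B3; have [_ mk] := ord_lt_neq km.
have [_ mj] := ord_lt_neq (ltn_trans jk km).
have Jm : J ord0 m <= hi m - 1.
  by move: (B3 m); rewrite !coord_add_basis eqxx mk mj; lia.
have low K : int_box lo hi K -> K ord0 m <= hi m - 1 -> lower K.
  by move=> BK Km; apply/lower_layerP; split=> //; lia.
have [Jm'|Jm'] := ltP (J ord0 m) (hi m - 1).
  rewrite /cube_relation /hexagon_sum /top_vertex /bottom_vertex.
  rewrite !glue_low ?coord_add_basis ?eqxx ?mk ?mj /=; try lia.
  apply: X_cube; rewrite ?jk ?km //; apply: low => //.
  by rewrite !coord_add_basis eqxx mk mj; lia.
have {Jm'} Jm : J ord0 m = hi m - 1 by lia.
have Jjm : (J + e j) ord0 m = hi m - 1 by rewrite coord_add_basis mj addr0.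
have Jkm : (J + e k) ord0 m = hi m - 1 by rewrite coord_add_basis mk addr0.
have Jjkm : (J + e j + e k) ord0 m = hi m - 1 by rewrite coord_add_basis mk addr0.
rewrite /cube_relation /hexagon_sum /top_vertex /bottom_vertex !glued_top //.
rewrite !glue_low ?Jjkm ?Jjm ?Jkm ?Jm //.
have [_ [Bjk _ _]] := int_box_cube B B3.
by apply: Y_moutard => //; apply/top_layerP.
Qed.

Lemma moutard_cube : cube_relations_on [eta lo with m |-> (hi m - 1)%R]
  [eta hi with m |-> (hi m - 1)%R] Y.
Proof.
move=> J j k l jkl B B3; have /andP[jk kl] := jkl.
have [[Bj Bk Bl] [Bjk Bjl Bkl]] := int_box_cube B B3.
have lower_of_layer K : layer K -> lower K.
  by move=> /top_layerP[BK Km]; apply/lower_layerP; split=> //; lia.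
have X_neq0 K : layer K -> X K != 0 by move=> /lower_of_layer/X_gt0/gt_eqF ->.
have Xrel : cube_relation X J j k l by apply: X_cube => //; exact: lower_of_layer.
have Yjl : moutard X Y J j l by apply: Y_moutard => //; exact: ltn_trans kl.
have Ykl : moutard X Y J k l by exact: Y_moutard.
have Yjk : moutard X Y (J + e l) j k.
  by apply: Y_moutard; rewrite // ![J + e l + _]addrAC // [J + e j + e l + _]addrAC.
have Yjkl : moutard X Y (J + e j) k l by exact: Y_moutard.
rewrite /moutard ![J + e l + _]addrAC [J + e j + e l + _]addrAC in Yjk.
exact: (moutard_transform (X_neq0 _ Bk) (X_neq0 _ Bl) (X_neq0 _ Bjl)
  (X_neq0 _ Bkl) Xrel Yjl Ykl Yjk Yjkl).
Qed.

Lemma glue_cube_along J j k l : (j < k < l)%N -> (l < m)%N -> int_box lo hi J ->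
  int_box lo hi (J + e j + e k + e l) -> cube_relation glued J j k l.
Proof.
move=> jkl lm B B3; have /andP[jk kl] := jkl; have [ltm _] := lastm.
have [_ ml] := ord_lt_neq lm; have [_ mk] := ord_lt_neq (ltn_trans kl lm).
have [_ mj] := ord_lt_neq (ltn_trans jk (ltn_trans kl lm)).
have [Jm|Jm] := ltP (J ord0 m) (hi m).
  rewrite /cube_relation /hexagon_sum /top_vertex /bottom_vertex.
  rewrite !glue_low ?coord_add_basis ?mk ?mj ?ml ?addr0 //; try lia.
  by apply: X_cube => //; apply/lower_layerP;
    rewrite ?coord_add_basis ?ml ?mk ?mj ?addr0.
have {}Jm : J ord0 m = hi m by move: (B m); lia.
pose K := J - e m; have JE : J = K + e m by rewrite subrK.
have Km : K ord0 m = hi m - 1 by rewrite coord_sub_basis eqxx Jm.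
have inlayer L : int_box lo hi L -> L ord0 m = hi m -> layer (L - e m).
  move=> BL Lm; apply/top_layerP; split; last by rewrite coord_sub_basis eqxx Lm.
  by move=> i; move: (BL i) Lm ltm; coords i; lia.
rewrite /cube_relation /hexagon_sum /top_vertex /bottom_vertex JE.
rewrite ![K + e m + _]addrAC ![K + _ + e m + _]addrAC ![K + _ + _ + e m + _]addrAC.
rewrite !glued_top ?coord_add_basis ?mj ?mk ?ml ?addr0 //.
apply: moutard_cube => //; first exact: inlayer.
have -> : K + e j + e k + e l = J + e j + e k + e l - e m.
  by rewrite /K !(addrAC _ (- e m)).
by apply: inlayer; rewrite // !coord_add_basis mj mk ml !addr0.
Qed.

Lemma glue_cube : cube_relations_on lo hi glued.
Proof.
move=> J j k l jkl B B3; have [_ [Bjk _ _]] := int_box_cube B B3.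
have := step_le_last lastm Bjk B3; rewrite leq_eqVlt => /predU1P[/ord_inj lm|lm].
  by subst l; exact: glue_cube_across.
exact: glue_cube_along.
Qed.

End CubeLayer.

Lemma interval_suffix_form lo hi m J : last_direction lo hi m -> int_box lo hi J ->
  interval_form lo hi J -> J ord0 m = hi m ->
  suffix_form [eta lo with m |-> (hi m - 1)%R] [eta hi with m |-> (hi m - 1)%R]
    (J - e m).
Proof.
move=> [ltm flat] B itv Jm i k ik; rewrite !coord_sub_basis /=.
have [->|im] := eqVneq i m; first by rewrite Jm /=; lia.
have [->|km] := eqVneq k m; first by rewrite Jm.
rewrite !subr0 => loi; have [mk|mk] := ltnP m k.
  by move: (flat k mk) (B k); lia.
by apply: (itv i k m) => //; [rewrite ik ltn_neqAle km|rewrite Jm].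
Qed.

(* The solution is built one layer of the last direction at a time; on the
   layer added last the interval data become data in suffix form. *)
Lemma cube_extension lo hi (x0 : 'rV[int]_n -> F) : (forall J, 0 < x0 J) ->
  exists X, [/\ positive_on lo hi X, cube_relations_on lo hi X &
    forall J, int_box lo hi J -> interval_form lo hi J -> X J = x0 J].
Proof.
move=> x0_gt0; have [N] := ubnP (box_size lo hi).
elim: N lo hi => // N IH lo hi; rewrite ltnS => leN.
have [flat|[m lastm]] := last_directionP lo hi.
  exists x0; split=> // J j k l _ B B3.
  by move: (flat l) (B l) (B3 l); rewrite !coord_add_basis eqxx; lia.
have [ltm flat] := lastm.
have [|X [X_gt0 X_cube X_itv]] := IH lo [eta hi with m |-> (hi m - 1)%R].
  exact: leq_trans (box_size_lower_hi ltm) leN.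
pose layer := int_box [eta lo with m |-> (hi m - 1)%R] [eta hi with m |-> (hi m - 1)%R].
have lower_of_layer J : layer J -> int_box lo [eta hi with m |-> (hi m - 1)%R] J.
  by move=> /top_layerP[]// B Jm; apply/lower_layerP; split=> //; lia.
have [|||Y [Y_gt0 Y_moutard Y_suffix]] := @moutard_extension
    [eta lo with m |-> (hi m - 1)%R] [eta hi with m |-> (hi m - 1)%R] X
    (fun J => x0 (J + e m)).
- by [].
- by move=> J /lower_of_layer/X_gt0.
- by move=> J j k l jkl /lower_of_layer B /lower_of_layer B3; exact: X_cube.
have top J : int_box lo hi J -> hi m - 1 < J ord0 m ->
    J ord0 m = hi m /\ layer (J - e m).
  move=> B ltJ; have Jm : J ord0 m = hi m by move: (B m); lia.
  split=> //; apply/top_layerP => //; split; last by rewrite coord_sub_basis eqxx Jm.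
  by move=> i; move: (B i) Jm ltm; coords i; lia.
have low J : int_box lo hi J -> J ord0 m <= hi m - 1 ->
    int_box lo [eta hi with m |-> (hi m - 1)%R] J.
  by move=> B leJ; apply/lower_layerP; split=> //; lia.
exists (glue m (hi m - 1) X (fun J => Y (J - e m))); split.
- move=> J B; have [Jm|Jm] := leP (J ord0 m) (hi m - 1).
    by rewrite glue_low // X_gt0 //; exact: low.
  by rewrite glue_high // Y_gt0 //; case: (top J B Jm).
- exact: glue_cube.
- move=> J B itv; have [leJ|ltJ] := leP (J ord0 m) (hi m - 1).
    rewrite glue_low // X_itv //; first exact: low.
    move=> i k l ikl loi lol /=; have [km|_] := eqVneq k m; last exact: itv ikl _ _.
    have /flat : (m < l)%N by case/andP: ikl; rewrite km.
    by move: (B l) lol; lia.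
  have [Jm Btop] := top J B ltJ.
  rewrite glue_high // Y_suffix ?subrK //; exact: interval_suffix_form.
Qed.

End CubeRelations.

(** * Cells, cubes and flips *)

Section Cells.
Variable n : nat.
Implicit Types (c d f : cell n) (v w J K : 'rV[int]_n) (i j k l : 'I_n).
Implicit Type T : set (cell n).
Local Notation e := (@basis_vec n).

Definition face_closed T := forall c d, T c -> face_of d c -> T d.

Lemma cell_ext c d : (forall i, c.1 ord0 i = d.1 ord0 i) ->
  (forall i, (i \in c.2) = (i \in d.2)) -> c = d.
Proof.
case: c d => [I A] [I' A'] /= EI EA; congr pair; first exact: eq_from_coord.
by apply/setP => i; exact: EA.
Qed.

Lemma face_of_refl c : face_of c c.
Proof. by split=> // i; rewrite lexx ler_wpDr. Qed.

Lemma face_of_trans d c f : face_of d c -> face_of c f -> face_of d f.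
Proof.
move=> [sdc dc] [scf cf]; split; first exact: fintype.subset_trans scf.
move=> i; move: (dc i) (cf i); rewrite !inE.
case: (boolP (i \in c.2)) => ic; case: (boolP (i \in d.2)) => id /=.
- by lia.
- by rewrite (fintype.subsetP scf _ ic) /=; lia.
- by rewrite (fintype.subsetP sdc _ id) in ic.
- by case: (i \in f.2) => /=; lia.
Qed.

Lemma vertex_faceP v c : face_of (vertex v) c <->
  forall i, c.1 ord0 i <= v ord0 i <= c.1 ord0 i + (i \in c.2)%:Z.
Proof.
split=> [[_ +] i|H]; first by move=> /(_ i) /=; rewrite finset.setD0.
by split=> [|i]; rewrite /= ?finset.sub0set // finset.setD0.
Qed.

Lemma face_of_vertexP J d : face_of d (vertex J) -> d = vertex J.
Proof.
move=> [sd dJ]; have d0 i : (i \in d.2) = false.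
  apply: contraTF sd => id; apply/fintype.subsetPn; exists i => //.
  by rewrite inE.
by apply: cell_ext => i; [move: (dJ i)|]; rewrite /= !inE ?d0 // andbF /=; lia.
Qed.

Definition opposite c v w := forall i,
  if i \in c.2 then (v ord0 i == c.1 ord0 i) && (w ord0 i == c.1 ord0 i + 1)
                 || (v ord0 i == c.1 ord0 i + 1) && (w ord0 i == c.1 ord0 i)
  else (v ord0 i == c.1 ord0 i) && (w ord0 i == c.1 ord0 i).

Lemma opposite_sym c v w : opposite c v w -> opposite c w v.
Proof. by move=> op i; move: (op i); case: (i \in c.2); lia. Qed.

Lemma opposite_vertex c v w : opposite c v w -> face_of (vertex v) c.
Proof.
by move=> op; apply/vertex_faceP => i; move: (op i); case: (i \in c.2) => /=; lia.
Qed.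

Lemma opposite_neq c v w : (0 < #|c.2|)%N -> opposite c v w -> v <> w.
Proof. by move=> /card_gt0P[i ic] /(_ i); rewrite ic => + vw; rewrite vw; lia. Qed.

Definition facet c v i : cell n :=
  (\row_j if j == i then v ord0 i else c.1 ord0 j, c.2 :\ i).

Lemma card_facet c v i : i \in c.2 -> #|c.2| = #|(facet c v i).2|.+1.
Proof. by move=> ic; rewrite (cardsD1 i) ic. Qed.

Lemma face_facetP c v d i : face_of (vertex v) c -> i \in c.2 ->
  face_of d (facet c v i) <-> [/\ face_of d c, i \notin d.2 & d.1 ord0 i = v ord0 i].
Proof.
move=> /vertex_faceP vc ic; split=> [[sd df]|[[sd dc] id di]].
  have id : i \notin d.2.
    by apply: contraL sd => id; apply/fintype.subsetPn; exists i; rewrite ?inE ?eqxx.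
  have di : d.1 ord0 i = v ord0 i.
    by move: (df i); rewrite /facet /= mxE !inE eqxx andbF; lia.
  split=> //; split=> [|i']; first exact: fintype.subset_trans sd (finset.subsetDl _ _).
  have [->|ii] := eqVneq i' i; first by move: (vc i); rewrite di inE id ic.
  by move: (df i'); rewrite /facet /= mxE !inE (negbTE ii).
split=> [|i'].
  apply/fintype.subsetP => i' i'd; rewrite !inE (fintype.subsetP sd _ i'd) andbT.
  by apply: contraNneq id => <-.
rewrite /facet /= mxE !inE; have [->|ii] := eqVneq i' i; first by rewrite id di /=; lia.
by move: (dc i'); rewrite inE.
Qed.

Lemma vertex_facet c v i : face_of (vertex v) c -> i \in c.2 ->
  face_of (vertex v) (facet c v i).
Proof. by move=> vc ic; apply/face_facetP => //; split=> //; rewrite inE. Qed.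

Lemma facet_face c v i : face_of (vertex v) c -> i \in c.2 -> face_of (facet c v i) c.
Proof. by move=> vc ic; case/(face_facetP _ vc ic): (face_of_refl (facet c v i)). Qed.

Lemma faces_at_facetP c v d : #|c.2| = 3%N -> face_of (vertex v) c ->
  faces_at c v d <-> exists2 i, i \in c.2 & face_of d (facet c v i).
Proof.
move=> card3 vc; split=> [[f [fc f2 vf df]]|[i ic di]]; last first.
  exists (facet c v i); split=> //; [exact: facet_face| |exact: vertex_facet].
  by apply: succn_inj; rewrite -card3 (card_facet v ic).
have [|i ic ifN] := @fintype.subsetPn _ (mem c.2) (mem f.2) _.
  by apply/negP => /subset_leq_card; rewrite card3 -[#|_|]/(dim_cell f) f2.
exists i => //; apply: face_of_trans df _; apply/face_facetP => //; split=> //.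
by move/vertex_faceP: vf => /(_ i); rewrite (negbTE ifN); lia.
Qed.

Lemma faces_atP c v d : #|c.2| = 3%N -> face_of (vertex v) c ->
  faces_at c v d <-> face_of d c /\
    exists i, [/\ i \in c.2, i \notin d.2 & d.1 ord0 i = v ord0 i].
Proof.
move=> card3 vc; split=> [/(faces_at_facetP _ card3 vc)[i ic]|[dc [i [ic id di]]]].
  by move=> /(face_facetP _ vc ic)[dc id di]; split=> //; exists i.
by apply/faces_at_facetP => //; exists i => //; apply/face_facetP.
Qed.

Lemma faces_at_closed c v : face_closed (faces_at c v).
Proof.
by move=> d d' [f [fc f2 vf df]] dd; exists f; split=> //; exact: face_of_trans df.
Qed.

Lemma faces_at_sub c v T : #|c.2| = 3%N -> face_of (vertex v) c -> face_closed T ->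
  (forall i, i \in c.2 -> T (facet c v i)) -> faces_at c v `<=` T.
Proof.
by move=> card3 vc Tf Tv d /(faces_at_facetP _ card3 vc)[i ic]; apply: Tf; exact: Tv.
Qed.

Lemma facet_in_faces_at c v i : #|c.2| = 3%N -> face_of (vertex v) c -> i \in c.2 ->
  faces_at c v (facet c v i).
Proof.
by move=> card3 vc ic; apply/faces_at_facetP => //; exists i => //; exact: face_of_refl.
Qed.

Lemma faces_at_opposite c v w d : #|c.2| = 3%N -> opposite c v w ->
  face_of d c -> ~ face_of (vertex v) d -> faces_at c w d.
Proof.
move=> card3 op dc vd; apply/faces_atP => //.
  exact/opposite_vertex/opposite_sym/op.
split=> //; have [i /negP vi] : exists i,
    ~ (d.1 ord0 i <= v ord0 i <= d.1 ord0 i + (i \in d.2)%:Z).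
  apply: contrapT => /forallNP nv; apply: vd; apply/vertex_faceP => i.
  by apply: contrapT; exact: nv.
exists i; move: (op i); case: dc => sdc /(_ i); rewrite inE.
case: (boolP (i \in c.2)) => ic; last first.
  by case: (boolP (i \in d.2)) vi => [/(fintype.subsetP sdc)|] /=;
    rewrite ?(negbTE ic) //=; lia.
by move: vi; case: (i \in d.2) => /= vi dci opi; split=> //; lia.
Qed.

Lemma faces_at_vertex c v w K : #|c.2| = 3%N -> opposite c v w ->
  face_of (vertex K) c -> K <> w -> faces_at c v (vertex K).
Proof.
move=> card3 op Kc Kw; apply: faces_at_opposite Kc _ => //.
  exact: opposite_sym op.
by move=> /face_of_vertexP[] /esym.
Qed.

Lemma in_box_face (a : 'I_n -> nat) c d : in_box a c -> face_of d c -> in_box a d.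
Proof.
move=> bc [/fintype.subsetP s dc] i; move: (bc i) (dc i).
rewrite inE; case: (boolP (i \in d.2)) => [/s ->|_] /=; first by lia.
by case: (i \in c.2) => /=; lia.
Qed.

End Cells.

Section Cubes.
Variables (n : nat) (J : 'rV[int]_n) (j k l : 'I_n).
Hypothesis jkl : (j < k < l)%N.
Implicit Types (i : 'I_n) (v K : 'rV[int]_n) (b : bool) (T : set (cell n)).
Local Notation e := (@basis_vec n).

Let neqs : ((j == k) = false) * ((k == j) = false) * ((k == l) = false) *
  ((l == k) = false) * ((j == l) = false) * ((l == j) = false).
Proof.
have /andP[jk kl] := jkl; have jl := ltn_trans jk kl.
by rewrite !(ord_lt_neq jk) !(ord_lt_neq kl) !(ord_lt_neq jl).
Qed.

Lemma card_cube : #|(cube J j k l).2| = 3%N.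
Proof. by rewrite /cube /= finset.setUC cardsU1 cards2 !inE !neqs. Qed.

Lemma mem_cubeE i :
  (i \in (cube J j k l).2)%:Z = (i == j)%:Z + (i == k)%:Z + (i == l)%:Z.
Proof.
rewrite /cube /= !inE; have [->|_] := eqVneq i j; first by rewrite !neqs.
by have [->|_] := eqVneq i k; rewrite ?neqs.
Qed.

Lemma cube_opposite :
  opposite (cube J j k l) (bottom_vertex J j k l) (top_vertex J j k l).
Proof.
move=> i; have := mem_cubeE i; rewrite /bottom_vertex /top_vertex !coord_add_basis.
by case: (i \in _); case: (i == j); case: (i == k); case: (i == l) => //= _; lia.
Qed.

(* The vertices of the cube other than its bottom and top vertices; they lie on
   the common boundary of the bottom and top faces. *)
Definition hexagon : seq 'rV[int]_n :=
  [:: J; J + e j + e k + e l; J + e j + e k; J + e l; J + e k + e l; J + e j].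

Lemma hexagon_cube K : K \in hexagon -> face_of (vertex K) (cube J j k l).
Proof.
move=> KJ; apply/vertex_faceP => i; rewrite mem_cubeE /=; move: KJ; rewrite !inE.
by do 5?[case/predU1P => [->|]]; last move=> /eqP ->; rewrite ?coord_add_basis; lia.
Qed.

(* K_j - K_k + K_l - (J_j - J_k + J_l) is -1 at the bottom vertex, 2 at the top
   one, and 0 or 1 on the hexagon. *)
Lemma hexagon_neq K : K \in hexagon ->
  K <> bottom_vertex J j k l /\ K <> top_vertex J j k l.
Proof.
pose level (K' : 'rV[int]_n) := K' ord0 j - K' ord0 k + K' ord0 l.
move=> KJ; have lvl : level J <= level K <= level J + 1.
  by move: KJ; rewrite !inE; do 5?[case/predU1P => [->|]]; last move=> /eqP ->;
    rewrite /level ?coord_add_basis ?eqxx ?neqs /=; lia.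
by split=> KE; move: lvl; rewrite KE /level ?coord_add_basis ?eqxx ?neqs /=; lia.
Qed.

Lemma facet_shift v i b : v ord0 i = J ord0 i + b%:Z ->
  facet (cube J j k l) v i = (J + e i *+ b, ([set j; k; l] :\ i)%SET).
Proof.
move=> vi; congr pair; apply: eq_from_coord => i'; rewrite mxE.
have [->|ii] := eqVneq i' i.
  by rewrite vi; case: (b); rewrite ?coord_add_basis ?eqxx ?mulr0n ?addr0.
by case: (b); rewrite ?coord_add_basis ?(negbTE ii) ?mulr0n ?addr0.
Qed.

Let cubeD : [/\ ([set j; k; l] :\ j = [set k; l])%SET,
  ([set j; k; l] :\ k = [set j; l])%SET & ([set j; k; l] :\ l = [set j; k])%SET].
Proof.
split; apply/setP => i; rewrite !inE.
- by case: (eqVneq i j) => [->|_]; rewrite ?neqs.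
- by case: (eqVneq i k) => [->|_]; rewrite ?neqs ?orbF.
- by case: (eqVneq i l) => [->|_]; rewrite ?neqs ?orbF.
Qed.

Let cubeU (P : 'I_n -> Prop) : P j -> P k -> P l ->
  forall i, i \in (cube J j k l).2 -> P i.
Proof. by move=> Pj Pk Pl i; rewrite /cube /= !inE => /orP[/orP[]|] /eqP ->. Qed.

Lemma bottom_facets : let bottom := facet (cube J j k l) (bottom_vertex J j k l) in
  [/\ bottom j = (J, [set k; l]%SET), bottom k = (J + e k, [set j; l]%SET) &
      bottom l = (J, [set j; k]%SET)].
Proof.
have [Dj Dk Dl] := cubeD; rewrite /bottom_vertex.
by split; [rewrite (@facet_shift _ _ false)|rewrite (@facet_shift _ _ true)|
  rewrite (@facet_shift _ _ false)];
  rewrite ?coord_add_basis ?eqxx ?neqs ?mulr0n ?addr0 ?Dj ?Dk ?Dl.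
Qed.

Lemma top_facets : let top := facet (cube J j k l) (top_vertex J j k l) in
  [/\ top j = (J + e j, [set k; l]%SET), top k = (J, [set j; l]%SET) &
      top l = (J + e l, [set j; k]%SET)].
Proof.
have [Dj Dk Dl] := cubeD; rewrite /top_vertex.
by split; [rewrite (@facet_shift _ _ true)|rewrite (@facet_shift _ _ false)|
  rewrite (@facet_shift _ _ true)];
  rewrite ?coord_add_basis ?eqxx ?neqs ?mulr0n ?addr0 ?Dj ?Dk ?Dl.
Qed.

Lemma bottom_faces_sub T : face_closed T -> T (J, [set k; l]%SET) ->
  T (J + e k, [set j; l]%SET) -> T (J, [set j; k]%SET) ->
  faces_at (cube J j k l) (bottom_vertex J j k l) `<=` T.
Proof.
have [fj fk fl] := bottom_facets => Tf Tkl Tjl Tjk; apply: faces_at_sub => //.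
- exact: card_cube.
- exact/opposite_vertex/cube_opposite.
- by apply: cubeU; rewrite ?fj ?fk ?fl.
Qed.

Lemma top_faces_sub T : face_closed T -> T (J + e j, [set k; l]%SET) ->
  T (J, [set j; l]%SET) -> T (J + e l, [set j; k]%SET) ->
  faces_at (cube J j k l) (top_vertex J j k l) `<=` T.
Proof.
have [fj fk fl] := top_facets => Tf Tkl Tjl Tjk; apply: faces_at_sub => //.
- exact: card_cube.
- exact/opposite_vertex/opposite_sym/cube_opposite.
- by apply: cubeU; rewrite ?fj ?fk ?fl.
Qed.

Lemma bottom_tile : faces_at (cube J j k l) (bottom_vertex J j k l) (J, [set j; k]%SET).
Proof.
have [_ _ <-] := bottom_facets; apply: facet_in_faces_at; first exact: card_cube.
  exact/opposite_vertex/cube_opposite.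
by rewrite /cube /= !inE eqxx orbT.
Qed.

Lemma top_tile : faces_at (cube J j k l) (top_vertex J j k l) (J + e j, [set k; l]%SET).
Proof.
have [<- _ _] := top_facets; apply: facet_in_faces_at; first exact: card_cube.
  exact/opposite_vertex/opposite_sym/cube_opposite.
by rewrite /cube /= !inE eqxx.
Qed.

End Cubes.

Section Flip.
Variables (n : nat) (a : 'I_n -> nat) (J : 'rV[int]_n) (j k l : 'I_n).
Variables (v w : 'rV[int]_n) (T T' : set (cell n)).
Hypothesis fl : flip_in a J j k l v w T T'.
Local Notation e := (@basis_vec n).
Local Notation c := (cube J j k l).
Implicit Types (K : 'rV[int]_n).

Let jkl : (j < k < l)%N. Proof. by case: fl. Qed.

Let card3 : #|c.2| = 3%N. Proof. exact: card_cube. Qed.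

Lemma flip_opposite : opposite c v w.
Proof.
by case: fl => _ _ [[-> ->]|[-> ->]] _; [|apply: opposite_sym]; exact: cube_opposite.
Qed.

Let vw_neq : v <> w.
Proof. by apply: opposite_neq flip_opposite; rewrite card3. Qed.

Lemma flip_in_box K : face_of (vertex K) c -> int_box (fun=> 0) (fun i => (a i)%:Z) K.
Proof. by case: fl => _ bc _ _ /vertex_faceP Kc i; move: (bc i) (Kc i); lia. Qed.

Lemma flip_cube_vertex K : face_of (vertex K) c -> K <> w -> T (vertex K).
Proof.
move=> Kc Kw; case: fl => _ _ _ [sub _]; apply: sub.
exact: faces_at_vertex card3 flip_opposite Kc Kw.
Qed.

Lemma flip_old_vertex : T (vertex v).
Proof. exact: flip_cube_vertex (opposite_vertex flip_opposite) vw_neq. Qed.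

Lemma flip_vertexP K : K <> v -> K <> w -> T (vertex K) <-> T' (vertex K).
Proof.
have op := flip_opposite; have vc := opposite_vertex op.
have wc := opposite_vertex (opposite_sym op); case: fl => _ _ _ [sub ->] Kv Kw.
split=> [TK|[[]//|/(faces_atP _ card3 wc)[Kc _]]]; last first.
  by apply: sub; exact: faces_at_vertex Kc Kw.
have [/(faces_atP _ card3 vc)[Kc _]|fK] := pselect (faces_at c v (vertex K)).
  by right; exact: faces_at_vertex (opposite_sym op) Kc Kv.
by left.
Qed.

Lemma flip_hexagon K : K \in hexagon J j k l -> [/\ T (vertex K), K <> v & K <> w].
Proof.
move=> KJ; have [Kb Kt] := hexagon_neq jkl KJ; have Kc := hexagon_cube jkl KJ.
have [Kv Kw] : K <> v /\ K <> w by case: fl => _ _ [[-> ->]|[-> ->]] _.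
by split=> //; exact: flip_cube_vertex.
Qed.

Lemma flip_in_sym : face_closed T -> ~ T (vertex w) -> flip_in a J j k l w v T' T.
Proof.
move=> Tf Tw; have op := flip_opposite; case: (fl) => _ bc vw [sub T'E].
split=> //; first by case: vw => -[-> ->]; [right|left].
split=> [d fd|]; first by rewrite T'E; right.
apply/seteqP; split=> [d Td|d [[T'd fd]|/sub//]]; last first.
  by move: T'd; rewrite T'E => -[[]|].
have [fd|fd] := pselect (faces_at c v d); [by right|left; split].
  by rewrite T'E; left.
move=> /(faces_atP _ card3 (opposite_vertex (opposite_sym op)))[dc _]; apply: fd.
apply: (faces_at_opposite card3 (opposite_sym op) dc) => wd.
by apply: Tw; exact: Tf Td wd.
Qed.

End Flip.

Section FlipValues.
Variables (F : realFieldType) (n : nat) (a : 'I_n -> nat).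
Implicit Types (T : set (cell n)) (J K : 'rV[int]_n) (x X : 'rV[int]_n -> F).
Local Notation e := (@basis_vec n).
Local Notation zero := (fun=> 0 : int).
Local Notation top := (fun i => (a i)%:Z).

Lemma hexagon_sum_eq x X J (j k l : 'I_n) : {in hexagon J j k l, x =1 X} ->
  hexagon_sum x J j k l = hexagon_sum X J j k l.
Proof. by move=> xX; rewrite /hexagon_sum !xX // !inE eqxx ?orbT. Qed.

Lemma hexagon_sum_gt0 x J (j k l : 'I_n) : {in hexagon J j k l, forall K, 0 < x K} ->
  0 < hexagon_sum x J j k l.
Proof.
by move=> x_gt0; rewrite !addr_gt0 // mulr_gt0 // x_gt0 // !inE eqxx ?orbT.
Qed.

Lemma flip_values_sym T T' x x' : flip_values a T T' x x' -> face_closed T ->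
  (forall J j k l v w, flip_in a J j k l v w T T' -> ~ T (vertex w)) ->
  flip_values a T' T x' x.
Proof.
move=> [J [j [k [l [v [w [fl x'E rel]]]]]]] Tf /(_ _ _ _ _ _ _ fl) Tw.
have x'x K : T (vertex K) -> K <> v -> x' K = x K.
  have [->|Kw] := pselect (K = w); first by move=> /Tw.
  by move=> TK Kv; apply: x'E => //; apply/(flip_vertexP fl).
exists J, j, k, l, w, v; split; first exact: flip_in_sym.
  by move=> K TK Kv; rewrite x'x.
rewrite mulrC rel; apply: hexagon_sum_eq => K /(flip_hexagon fl)[TK Kv Kw].
by rewrite x'x.
Qed.

Lemma flip_values_exist T T' x : flip a T T' -> (forall K, T (vertex K) -> 0 < x K) ->
  exists x', flip_values a T T' x x' /\ forall K, T' (vertex K) -> 0 < x' K.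
Proof.
move=> [J [j [k [l [v [w fl]]]]]] x_gt0; have xv_gt0 := x_gt0 v (flip_old_vertex fl).
exists (fun K => if K == w then hexagon_sum x J j k l / x v else x K); split.
  exists J, j, k, l, v, w; split=> // [K _ /eqP/negbTE -> //|].
  by rewrite eqxx divfK // gt_eqF.
move=> K TK; case: eqP => Kw.
  by rewrite divr_gt0 // hexagon_sum_gt0 // => L /(flip_hexagon fl)[/x_gt0].
have [->//|Kv] := pselect (K = v).
by apply: x_gt0; apply/(flip_vertexP fl).
Qed.

Lemma values_along_exist m (s : nat -> set (cell n)) x :
  (forall i, (i < m)%N -> flip a (s i) (s i.+1)) ->
  (forall K, s 0%N (vertex K) -> 0 < x K) ->
  exists xs, values_along a m s x xs /\ forall K, s m (vertex K) -> 0 < xs m K.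
Proof.
move=> + x_gt0; elim: m => [|m IH] fl; first by exists (fun=> x); split.
have [|xs [[xs0 xsS] xs_gt0]] := IH; first by move=> i im; apply: fl; exact: ltnW.
have [x' [fv x'_gt0]] := flip_values_exist (fl m (ltnSn m)) xs_gt0.
exists (fun i => if (i <= m)%N then xs i else x'); split; last by rewrite ltnn.
split=> // i; rewrite ltnS => im; rewrite im.
by move: im; rewrite leq_eqVlt => /orP[/eqP ->|im]; rewrite ?ltnn // im; exact: xsS.
Qed.

Section Solution.
Variable X : 'rV[int]_n -> F.
Hypothesis X_gt0 : positive_on zero top X.
Hypothesis X_cube : cube_relations_on zero top X.

Definition agree_on T x := forall K, T (vertex K) -> x K = X K.

Lemma flip_values_solution T T' x x' : flip_values a T T' x x' ->
  agree_on T x -> agree_on T' x'.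
Proof.
move=> [J [j [k [l [v [w [fl x'E rel]]]]]]] xX K TK; have vT := flip_old_vertex fl.
have jkl : (j < k < l)%N by case: fl.
have hex_box L : L \in hexagon J j k l -> int_box zero top L.
  by move=> /(hexagon_cube jkl)/(flip_in_box fl).
have Xv_neq0 : X v != 0.
  rewrite gt_eqF // X_gt0 //; apply: (flip_in_box fl).
  exact/opposite_vertex/(flip_opposite fl).
have Xrel : X w * X v = hexagon_sum X J j k l.
  have := X_cube jkl (hex_box J _) (hex_box (J + e j + e k + e l) _).
  rewrite !inE !eqxx ?orbT => <- //.
  by case: fl => _ _ [[-> ->]|[-> ->]] _; rewrite // mulrC.
have [->|Kw] := pselect (K = w).
  apply: (mulIf Xv_neq0); rewrite Xrel -[X v]xX // rel.
  by apply: hexagon_sum_eq => L /(flip_hexagon fl)[/xX].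
rewrite x'E // xX //; have [->//|Kv] := pselect (K = v).
exact/(flip_vertexP fl).
Qed.

Lemma values_along_solution m s x xs : values_along a m s x xs ->
  agree_on (s 0%N) x -> agree_on (s m) (xs m).
Proof.
move=> [xs0 xsS] xX; elim: m xsS => [|m IH] xsS.
  by move=> K sK; rewrite xs0 // xX.
apply: (flip_values_solution (xsS m (ltnSn m))).
by apply: IH => i im; apply: xsS; exact: ltnW.
Qed.

Lemma values_along_solution_back m s x xs : values_along a m s x xs ->
  (forall i, (i < m)%N -> face_closed (s i)) ->
  (forall i, (i < m)%N -> forall J j k l v w,
     flip_in a J j k l v w (s i) (s i.+1) -> ~ s i (vertex w)) ->
  agree_on (s m) (xs m) -> agree_on (s 0%N) x.
Proof.
move=> [xs0 xsS]; elim: m xsS => [|m IH] xsS sf sw xsX.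
  by move=> K sK; rewrite -xs0 // xsX.
apply: IH => [i im|i im|i im|]; [apply: xsS|apply: sf|apply: sw|]; try exact: ltnW.
apply: flip_values_solution xsX.
exact: flip_values_sym (xsS m (ltnSn m)) (sf m (ltnSn m)) (sw m (ltnSn m)).
Qed.

End Solution.

End FlipValues.

(** * Planar fans *)

Section LinearForms.
Variables (R : comNzRingType) (n : nat).
Implicit Types (p : 'rV[R]_n) (f : 'I_n -> R) (i j k : 'I_n) (x y : R).
Local Notation E i := (delta_mx ord0 i : 'rV[R]_n).

Definition lin f p : R := \sum_i p ord0 i * f i.

Fact lin_is_scalar f : scalar (lin f).
Proof.
move=> x p q; rewrite /lin mulr_sumr -big_split; apply: eq_bigr => i _.
by rewrite !mxE mulrDl mulrA.
Qed.

HB.instance Definition _ f := GRing.isLinear.Build R 'rV[R]_n R *%R (lin f)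
  (lin_is_scalar f).

Lemma lin_delta f i : lin f (E i) = f i.
Proof.
rewrite /lin (bigD1 i) //= big1 ?addr0 => [|j ji]; first by rewrite mxE !eqxx mul1r.
by rewrite mxE (negbTE ji) andbF mul0r.
Qed.

Lemma coord2 j k x y i :
  (x *: E j + y *: E k) ord0 i = x * (i == j)%:R + y * (i == k)%:R.
Proof. by rewrite !mxE !eqxx. Qed.

Lemma lin2 f j k x y : lin f (x *: E j + y *: E k) = x * f j + y * f k.
Proof. by rewrite linearD !linearZ /= !lin_delta. Qed.

Definition supported (A : {set 'I_n}) p := forall i, i \notin A -> p ord0 i = 0.

Lemma supported1 p j : supported [set j] p -> p = p ord0 j *: E j.
Proof.
move=> sp; apply: eq_from_coord => i; rewrite [in RHS]mxE mxE eqxx.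
by have [->|ij] := eqVneq i j; rewrite ?mulr1 // mulr0 sp // inE.
Qed.

Lemma supported2 p j k : j != k -> supported [set j; k] p ->
  p = p ord0 j *: E j + p ord0 k *: E k.
Proof.
move=> jk sp; apply: eq_from_coord => i; rewrite coord2.
have [->|ij] := eqVneq i j; first by rewrite (negbTE jk) mulr1 mulr0 addr0.
have [->|ik] := eqVneq i k; first by rewrite mulr0 mulr1 add0r.
by rewrite !mulr0 addr0 sp // !inE negb_or ij.
Qed.

End LinearForms.

Section Fans.
Variables (R : realFieldType) (n : nat) (vx vy : 'I_n -> R).
Implicit Types (p q r : 'rV[R]_n) (i j k : 'I_n) (A : {set 'I_n}).
Local Notation E i := (delta_mx ord0 i : 'rV[R]_n).

Definition cross i j : R := vx i * vy j - vy i * vx j.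

(* The vectors (vx i, vy i) lie in the upper half plane, ordered
   counterclockwise. *)
Definition fan :=
  (forall i, 0 < vy i) /\ (forall i j, (i < j)%N -> 0 < cross i j).

Hypothesis v_fan : fan.

Definition same_proj p q := lin vx p = lin vx q /\ lin vy p = lin vy q.

Lemma same_proj_sym p q : same_proj p q -> same_proj q p.
Proof. by case. Qed.

Lemma same_proj_trans p q r : same_proj p q -> same_proj q r -> same_proj p r.
Proof. by move=> [E1 E2] [E3 E4]; split; rewrite ?E1 ?E2. Qed.

Lemma same_projD p q p' q' : same_proj p q -> same_proj p' q' ->
  same_proj (p + p') (q + q').
Proof. by move=> [px py] [qx qy]; split; rewrite !linearD /= ?px ?py ?qx ?qy. Qed.

Lemma same_projZ t p q : same_proj p q -> same_proj (t *: p) (t *: q).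
Proof. by move=> [px py]; split; rewrite !linearZ /= ?px ?py. Qed.

Lemma crossC i j : cross i j = - cross j i.
Proof. by rewrite /cross; ring. Qed.

Lemma crossii i : cross i i = 0.
Proof. by rewrite /cross mulrC subrr. Qed.

Lemma fan_vy_gt0 i : 0 < vy i.
Proof. by case: v_fan => + _; exact. Qed.

Lemma fan_cross_gt0 i j : (i < j)%N -> 0 < cross i j.
Proof. by case: v_fan => _; exact. Qed.

Lemma fan_cross_neq0 i j : i != j -> cross i j != 0.
Proof.
case: (ltngtP i j) => [ij _|ji _|/ord_inj ->]; last by rewrite eqxx.
  by rewrite gt_eqF // fan_cross_gt0.
by rewrite crossC oppr_eq0 gt_eqF // fan_cross_gt0.
Qed.

Lemma lin2_surj i j x y : i != j ->
  exists p, [/\ supported [set i; j] p, lin vx p = x & lin vy p = y].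
Proof.
move=> /fan_cross_neq0; rewrite /cross => cij.
pose s := (x * vy j - y * vx j) / cross i j.
pose t := (vx i * y - vy i * x) / cross i j.
exists (s *: E i + t *: E j); split; rewrite ?lin2 /s /t /cross; try by field.
move=> k; rewrite !inE negb_or coord2 => /andP[/negbTE -> /negbTE ->].
by rewrite !mulr0 addr0.
Qed.

Lemma lin2_inj i j p : i != j -> supported [set i; j] p -> same_proj p 0 -> p = 0.
Proof.
move=> ij sp; rewrite (supported2 ij sp) /same_proj !lin2 !linear0.
have cij := fan_cross_neq0 ij; move: (p ord0 i) (p ord0 j) => s t [ex ey].
have /eqP : s * cross i j = (s * vx i + t * vx j) * vy j - (s * vy i + t * vy j) * vx j.
  by rewrite /cross; ring.
have /eqP : t * cross i j = (s * vy i + t * vy j) * vx i - (s * vx i + t * vx j) * vy i.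
  by rewrite /cross; ring.
rewrite ex ey !mul0r subrr !mulf_eq0 (negbTE cij) !orbF => /eqP -> /eqP ->.
by rewrite !scale0r addr0.
Qed.

Lemma horizontal_delta j t : lin vy (t *: E j) = 0 -> t = 0.
Proof.
rewrite linearZ /= lin_delta => /eqP; rewrite mulf_eq0 => /orP[/eqP //|].
by rewrite gt_eqF ?fan_vy_gt0.
Qed.

Lemma cross_weighted_sum j p :
  \sum_i p ord0 i * cross i j = lin vx p * vy j - lin vy p * vx j.
Proof.
rewrite /lin !mulr_suml -sumrB; apply: eq_bigr => i _.
by rewrite /cross; ring.
Qed.

Lemma cross_leftward b m p : b != m -> supported [set b; m] p ->
  lin vy p = 0 -> lin vx p < 0 -> 0 < p ord0 m * cross b m.
Proof.
move=> bm sp py px; have := cross_weighted_sum b p.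
rewrite py mul0r subr0 (bigD1 b) //= (bigD1 m) 1?eq_sym //= big1 => [|i /andP[ib im]].
  rewrite addr0 crossii mulr0 add0r crossC mulrN => sumE.
  by rewrite -[_ * _]opprK sumE oppr_gt0 nmulr_rlt0 // fan_vy_gt0.
by rewrite sp ?mul0r // !inE negb_or ib.
Qed.

(* r is obtained from q by trading generators on the right of v_j for
   generators on its left. *)
Lemma extremal_point q r j :
  (forall i, (i < j)%N -> r ord0 i <= q ord0 i) ->
  (forall i, (j < i)%N -> q ord0 i <= r ord0 i) ->
  lin vy r = lin vy q -> lin vx r <= lin vx q /\ (lin vx r = lin vx q -> r = q).
Proof.
move=> lo hi yE; pose t i := (q - r) ord0 i * cross i j.
have t_ge0 i : 0 <= t i.
  rewrite /t !mxE; case: (ltngtP i j) => [ij|ji|/ord_inj ->].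
  - by apply: mulr_ge0; [rewrite subr_ge0; exact: lo|exact/ltW/fan_cross_gt0].
  - rewrite crossC mulrN -mulNr opprB.
    by apply: mulr_ge0; [rewrite subr_ge0; exact: hi|exact/ltW/fan_cross_gt0].
  - by rewrite crossii mulr0.
have tE : \sum_i t i = (lin vx q - lin vx r) * vy j.
  by rewrite cross_weighted_sum !linearB /= yE subrr mul0r subr0.
split; first by rewrite -subr_ge0 -(pmulr_lge0 _ (fan_vy_gt0 j)) -tE sumr_ge0.
move=> xE; have t0 i : t i = 0.
  have /eqP := tE; rewrite xE subrr mul0r psumr_eq0 // => /allP/(_ i).
  by rewrite mem_index_enum => /(_ isT)/eqP.
have qrE : q - r = (q - r) ord0 j *: E j.
  apply: supported1 => i; rewrite inE => ij; have /eqP := t0 i.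
  by rewrite mulf_eq0 (negbTE (fan_cross_neq0 ij)) orbF => /eqP.
have /horizontal_delta z0 : lin vy ((q - r) ord0 j *: E j) = 0.
  by rewrite -qrE linearB /= yE subrr.
by apply/esym/eqP; rewrite -subr_eq0 qrE z0 scale0r.
Qed.

End Fans.

(** * Realizations and projections *)

Lemma homeomorphism_on_compact (X : ptopologicalType) (Y : topologicalType)
    (A : set X) (B : set Y) (f : X -> Y) : hausdorff_space Y ->
  compact A -> {within A, continuous f} -> set_bij A B f -> homeomorphism_on A B f.
Proof.
move=> hY cA cf bij; split=> //; split=> //.
have [fAB finj fsurj] := bij.
pose g y := xget point [set x | A x /\ f x = y].
have gP y : B y -> A (g y) /\ f (g y) = y.
  move=> /fsurj[x Ax <-].
  by apply: (@xgetPex _ point [set x' | A x' /\ f x' = f x]); exists x.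
have gf x : A x -> g (f x) = x.
  by move=> Ax; have [Ag fg] := gP (f x) (fAB _ Ax); apply: finj => //; exact: mem_set.
exists g; split=> //; apply/continuous_closedP => D cD; apply/closed_subspaceP.
exists (f @` (A `&` D)).
  apply: compact_closed => //; apply: continuous_compact; last exact: compact_closedI.
  by apply: continuous_subspaceW cf => x [].
apply/seteqP; split=> [y [[x [Ax Dx] <-] By]|y [Dy By]].
  by split=> //; change (D (g (f x))); rewrite gf.
by split=> //; have [Ag fg] := gP y By; exists (g y).
Qed.

Section TilingTopology.
Import numFieldNormedType.Exports.
Variables (R : realType) (n : nat).
Implicit Types (c : cell n) (T : set (cell n)).

Lemma compact_cell c : compact (@cell_points R n c).
Proof.
have := @rV_compact R n
  (fun i => `[(c.1 ord0 i)%:~R, (c.1 ord0 i + (i \in c.2)%:Z)%:~R]%classic).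
have -> : [set v : 'rV[R]_n | forall i, `[(c.1 ord0 i)%:~R,
    (c.1 ord0 i + (i \in c.2)%:Z)%:~R]%classic (v ord0 i)] = cell_points c.
  by apply/seteqP; split=> v /= Hv i; move: (Hv i); rewrite /= in_itv.
by apply=> i; exact: segment_compact.
Qed.

Lemma compact_realization (a : 'I_n -> nat) (T : set (cell n)) :
  (forall c, T c -> in_box a c) -> compact (@realization R n T).
Proof.
move=> Ta; pose N := \max_i a i.
pose mk (x : {ffun 'I_n -> 'I_N.+1} * {set 'I_n}) : cell n :=
  (\row_i (nat_of_ord (x.1 i))%:Z, x.2).
have -> : @realization R n T =
    \big[setU/set0]_(x | `[< T (mk x) >]) cell_points (mk x).
  apply/seteqP; split=> p.
    move=> [c [Tc pc]]; pose x := ([ffun i => inord `|c.1 ord0 i|%N], c.2)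
      : {ffun 'I_n -> 'I_N.+1} * {set 'I_n}.
    have cE : c = mk x.
      apply: cell_ext => i //; rewrite /mk /x /= mxE ffunE inordK.
        by case: (Ta c Tc i); lia.
      have : (a i <= N)%N by exact: leq_bigmax.
      by case: (Ta c Tc i); lia.
    rewrite -bigcup_seq_cond; exists x; last by rewrite -cE.
    by rewrite /= mem_index_enum -cE; apply/asboolP.
  by rewrite -bigcup_seq_cond => -[x /andP[_ /asboolP Tx] px]; exists (mk x).
by apply: bigsetU_compact => x _; exact: compact_cell.
Qed.

Lemma proj_continuous (theta : 'I_n -> R) : continuous (Defs.proj theta).
Proof.
have sum_continuous (f : 'I_n -> R) :
    continuous (fun p : 'rV[R]_n => \sum_i p ord0 i * f i).
  apply: continuous_big => [|i _ p]; first exact: add_continuous.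
  apply: (@cvgM R _ (nbhs p) _ (fun q : 'rV[R]_n => q ord0 i) (fun=> f i)).
    exact: (@coord_continuous R 1 n ord0 i p).
  exact: cvg_cst.
by move=> p; apply: (@cvg_pair _ _ _ (nbhs p) (nbhs _) (nbhs _)); exact: sum_continuous.
Qed.

Lemma homeomorphism_on_realization (a : 'I_n -> nat) (theta : 'I_n -> R) T
    (B : set (R * R)) : (forall c, T c -> in_box a c) ->
  set_bij (@realization R n T) B (Defs.proj theta) ->
  homeomorphism_on (@realization R n T) B (Defs.proj theta).
Proof.
move=> Ta; apply: homeomorphism_on_compact; first exact: norm_hausdorff.
  exact: compact_realization Ta.
by apply: continuous_subspaceT => p; exact: proj_continuous.
Qed.

Lemma within_continuous_coord (g : R * R -> 'rV[R]_n) (B : set (R * R)) x (delta : R) :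
  {within B, continuous g} -> B x -> 0 < delta ->
  exists2 eps, 0 < eps & forall y, B y -> `|x.1 - y.1| < eps -> `|x.2 - y.2| < eps ->
    forall i, `|g x ord0 i - g y ord0 i| < delta.
Proof.
move=> /subspace_continuousP gc Bx d_gt0.
have /(gc x Bx) : nbhs (g x) (ball (g x) delta) by exact: nbhsx_ballx.
rewrite /= /within /= => /nbhs_ballP[eps /= e_gt0 H].
exists eps => // y By y1 y2 i.
by have [|_ /(_ ord0 i)] := H y _ By; first by split.
Qed.

End TilingTopology.

Section Carriers.
Variables (R : realType) (n : nat).
Implicit Types (p q : 'rV[R]_n) (c d : cell n) (v : 'rV[int]_n) (i : 'I_n).
Local Notation intv := (map_mx (intr : int -> R)).

Lemma cell_pointsP c p : cell_points c p <->
  forall i, (c.1 ord0 i)%:~R <= p ord0 i <= (c.1 ord0 i)%:~R + (i \in c.2)%:R.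
Proof. by split=> H i; move: (H i); rewrite intrD. Qed.

Lemma in_box_points (a : 'I_n -> nat) c p :
  in_box a c -> cell_points c p -> @box R n a p.
Proof.
move=> ac /[swap] i pc; case: (ac i) => a1 a2; move: (pc i) => /andP[p1 p2].
apply/andP; split; first by apply: le_trans p1; rewrite ler0z.
by apply: le_trans p2 _; rewrite -(ler_int R) in a2.
Qed.

Definition carrier p : cell n :=
  (\row_i Num.floor (p ord0 i), [set i | (Num.floor (p ord0 i))%:~R != p ord0 i]%SET).

Lemma carrier_points p : cell_points (carrier p) p.
Proof.
move=> i; rewrite /carrier /= !mxE inE; have /andP[le lt] := floor_itv (p ord0 i).
rewrite le /=; case: eqP => [E|_] /=; first by rewrite addr0 E.
exact: ltW.
Qed.

Lemma carrier_face c p : cell_points c p -> face_of (carrier p) c.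
Proof.
move=> pc; have sub i : i \in (carrier p).2 -> i \in c.2.
  rewrite inE; apply: contraR => ic; move: (pc i); rewrite (negbTE ic) addr0.
  by rewrite -eq_le => /eqP <-; rewrite floorK // intr_int.
split=> [|i]; first exact/fintype.subsetP.
have /andP[le1 le2] := pc i; rewrite !inE mxE floor_ge_int le1 /=.
have /andP[fle flt] := floor_itv (p ord0 i).
case: eqP => [E|/eqP ne] /=; first by rewrite -(ler_int R) E.
rewrite addr0 -ltzD1 -(ltr_int R); apply: lt_le_trans (_ : p ord0 i <= _).
  by rewrite lt_neqAle ne.
apply: le_trans le2 _; rewrite ler_int lerD2l; by case: (i \in c.2).
Qed.

Lemma mem_carrier p i (z : int) : z%:~R < p ord0 i < (z + 1)%:~R -> i \in (carrier p).2.
Proof.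
move=> /andP[zp pz]; rewrite inE.
have /eqP -> : Num.floor (p ord0 i) == z by rewrite floor_eq ltW.
by rewrite lt_eqF.
Qed.

Lemma carrier_eq c p :
  (forall i, if i \in c.2 then (c.1 ord0 i)%:~R < p ord0 i < (c.1 ord0 i + 1)%:~R
             else p ord0 i == (c.1 ord0 i)%:~R) -> carrier p = c.
Proof.
move=> H; have E i : Num.floor (p ord0 i) = c.1 ord0 i.
  apply/eqP; rewrite floor_eq; move: (H i); case: ifP => _.
    by move=> /andP[/ltW -> ->].
  by move=> /eqP ->; rewrite lexx /= ltr_int ltzD1.
apply: cell_ext => i; rewrite /carrier /= ?mxE // inE E.
by move: (H i); case: ifP => _ => [/andP[/lt_eqF ->]|/eqP ->] //; rewrite eqxx.
Qed.

Lemma realization_carrier (T : set (cell n)) p :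
  face_closed T -> @realization R n T p <-> T (carrier p).
Proof.
move=> Tf; split=> [[c [Tc pc]]|Tp]; first exact: Tf Tc (carrier_face pc).
by exists (carrier p); split=> //; exact: carrier_points.
Qed.

Lemma face_points d c p : face_of d c -> cell_points d p -> cell_points c p.
Proof.
move=> [/fintype.subsetP sdc dc] pd i; move: (dc i) (pd i) => /andP[d1 d2] /andP[p1 p2].
apply/andP; split; first by apply: le_trans p1; rewrite ler_int.
apply: le_trans p2 _; rewrite ler_int; move: d1 d2; rewrite inE.
case: (boolP (i \in d.2)) => [/sdc ->|_] /=; first by lia.
by case: (i \in c.2) => /=; lia.
Qed.

Lemma faces_at_points c v p : #|c.2| = 3%N -> face_of (vertex v) c ->
  @realization R n (faces_at c v) p <->
  cell_points c p /\ exists2 i, i \in c.2 & p ord0 i = (v ord0 i)%:~R.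
Proof.
move=> card3 vc; split; last first.
  move=> [pc [i ic pi]].
  apply/(realization_carrier _ (@faces_at_closed _ _ _))/(faces_atP _ card3 vc).
  split; first exact: carrier_face.
  by exists i; rewrite /carrier /= inE mxE pi intrKfloor !eqxx.
move=> [d [/(faces_atP _ card3 vc)[dc [i [ic id di]]] pd]].
split; first exact: face_points pd.
by exists i => //; move: (pd i); rewrite (negbTE id) addr0 -eq_le di => /eqP.
Qed.

Lemma carrier_vertex v : carrier (intv v) = vertex v.
Proof. by apply: carrier_eq => i; rewrite inE !mxE. Qed.

Lemma vertex_points v : cell_points (vertex v) (intv v).
Proof. by have := carrier_points (intv v); rewrite carrier_vertex. Qed.

Definition center c : 'rV[R]_n :=
  \row_i ((c.1 ord0 i)%:~R + (i \in c.2)%:R / 2).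

Lemma center_carrier c : carrier (center c) = c.
Proof.
apply: carrier_eq => i; rewrite mxE; case: (i \in c.2) => /=.
  by rewrite intrD; apply/andP; split; lra.
by rewrite mul0r addr0.
Qed.

Lemma center_points c : cell_points c (center c).
Proof. by have := carrier_points (center c); rewrite center_carrier. Qed.

End Carriers.

(** * A flip of a tiling is a tiling *)

Section FibreDirections.
Variables (R : realType) (n : nat) (vx vy : 'I_n -> R).
Hypothesis v_fan : fan vx vy.
Implicit Types (p q : 'rV[R]_n) (c : cell n) (v w J : 'rV[int]_n) (i j k l : 'I_n).
Local Notation cross := (cross vx vy).
Local Notation same_proj := (same_proj vx vy).
Local Notation E i := (delta_mx ord0 i : 'rV[R]_n).
Local Notation intv := (map_mx (intr : int -> R)).

(* kappa spans the fibres of the projection of the cube c and points away from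
   c at its vertex v. *)
Definition fibre_direction c v (kappa : 'rV[R]_n) :=
  [/\ forall i, i \in c.2 ->
        if v ord0 i == c.1 ord0 i then kappa ord0 i < 0 else 0 < kappa ord0 i,
      supported c.2 kappa & same_proj kappa 0].

Lemma fibre_direction_opposite c v w kappa : opposite c v w ->
  fibre_direction c v kappa -> fibre_direction c w (- kappa).
Proof.
move=> op [sgn skappa [kx ky]]; split.
- move=> i ic; move: (op i) (sgn i ic); rewrite ic !mxE oppr_lt0 oppr_gt0.
  have cF : (c.1 ord0 i + 1 == c.1 ord0 i) = false by apply/eqP; lia.
  by case/orP => /andP[/eqP Ev /eqP Ew]; rewrite Ev Ew eqxx cF.
- by move=> i ic; rewrite mxE skappa ?oppr0.
- by split; rewrite linearN /= ?kx ?ky !linear0.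
Qed.

Lemma cube_fibre_direction J j k l : (j < k < l)%N ->
  exists kappa, fibre_direction (cube J j k l) (bottom_vertex J j k l) kappa.
Proof.
move=> jkl; have /andP[jk kl] := jkl; have jl := ltn_trans jk kl.
pose kappa := - cross k l *: E j + cross j l *: E k + - cross j k *: E l.
have coord i : kappa ord0 i =
    - cross k l * (i == j)%:R + cross j l * (i == k)%:R - cross j k * (i == l)%:R.
  by rewrite !mxE !eqxx !mulNr.
have linE f : lin f kappa = - cross k l * f j + cross j l * f k - cross j k * f l.
  by rewrite /kappa linearD /= lin2 linearZ /= lin_delta !mulNr.
exists kappa; split.
- move=> i; rewrite /cube /bottom_vertex /= !inE coord coord_add_basis.
  case/orP => [/orP[]|] /eqP ->;
    rewrite ?eqxx ?(ord_lt_neq jk) ?(ord_lt_neq kl) ?(ord_lt_neq jl) /=.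
  + by rewrite addr0 eqxx !mulr0 subr0 addr0 mulr1 oppr_lt0 fan_cross_gt0.
  + by rewrite gt_eqF ?ltrDl // !mulr0 subr0 add0r mulr1 fan_cross_gt0.
  + by rewrite addr0 eqxx !mulr0 addr0 sub0r mulr1 oppr_lt0 fan_cross_gt0.
- move=> i; rewrite coord /cube /= !inE !negb_or => /andP[/andP[]].
  by move=> /negbTE -> /negbTE -> /negbTE ->; rewrite !mulr0 subr0 addr0.
- by split; rewrite !linE linear0 /cross; ring.
Qed.

Section CubeProjection.
Variables (c : cell n) (v w : 'rV[int]_n) (kappa : 'rV[R]_n).
Hypothesis card3 : #|c.2| = 3%N.
Hypothesis op : opposite c v w.
Hypothesis kappa_fibre : fibre_direction c v kappa.

Let vc : face_of (vertex v) c. Proof. exact: opposite_vertex op. Qed.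

Let kappa_supp : supported c.2 kappa. Proof. by case: kappa_fibre. Qed.

Let kappa_proj : same_proj kappa 0. Proof. by case: kappa_fibre. Qed.

Let kappa_sign i : i \in c.2 ->
  (v ord0 i)%:~R = (c.1 ord0 i)%:~R :> R /\ kappa ord0 i < 0 \/
  (v ord0 i)%:~R = (c.1 ord0 i)%:~R + 1 :> R /\ 0 < kappa ord0 i.
Proof.
move=> ic; case: kappa_fibre => /(_ i ic) + _ _; move: (op i); rewrite ic.
case: eqVneq => [->|ne] /=; first by left.
by move=> /andP[/eqP -> _] k0; right; rewrite intrD.
Qed.

Let kappa_neq0 i : i \in c.2 -> kappa ord0 i != 0.
Proof. by move=> /kappa_sign[[_ /lt_eqF ->]|[_ /gt_eqF ->]]. Qed.

Let same_proj_add p t : same_proj (p + t *: kappa) p.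
Proof.
by case: kappa_proj => kx ky; split;
  rewrite linearD linearZ /= ?kx ?ky linear0 mulr0 addr0.
Qed.

Lemma fibre_direction_span delta : supported c.2 delta -> same_proj delta 0 ->
  exists t, delta = t *: kappa.
Proof.
move=> sd pd; have [i ic] : exists i, i \in c.2 by apply/card_gt0P; rewrite card3.
have /cards2P[j [k [jk cE]]] : #|c.2 :\ i| == 2%N.
  by rewrite -eqSS -card3 (cardsD1 i c.2) ic.
exists (delta ord0 i / kappa ord0 i); apply/eqP; rewrite -subr_eq0 -scaleNr; apply/eqP.
apply: (lin2_inj v_fan jk); last exact: same_proj_trans (same_proj_add _ _) pd.
move=> i'; rewrite -cE !inE negb_and negbK !mxE => /orP[/eqP ->|ic'].
  by rewrite mulNr divfK ?kappa_neq0 // subrr.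
by rewrite (sd i') // (kappa_supp ic') mulr0 addr0.
Qed.

(* Moving p along kappa until it first meets a facet through v. *)
Lemma push_to_faces p : cell_points c p ->
  exists q, same_proj q p /\ @realization R n (faces_at c v) q.
Proof.
move=> /cell_pointsP pc.
have [i0 i0c] : exists i, i \in c.2 by apply/card_gt0P; rewrite card3.
pose t i := ((v ord0 i)%:~R - p ord0 i) / kappa ord0 i.
have tE i : i \in c.2 -> t i * kappa ord0 i = (v ord0 i)%:~R - p ord0 i.
  by move=> ic; rewrite /t divfK ?kappa_neq0.
case: (@Order.TotalTheory.arg_minP _ _ _ i0 (mem c.2) t i0c) => i ic' mini.
have {ic'}ic : i \in c.2 by [].
have t_ge0 : 0 <= t i.
  move: (pc i) => /andP[p1 p2]; rewrite ic /= in p2; rewrite /t.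
  case: (kappa_sign ic) => [[-> k0]|[-> k0]].
    by rewrite -mulrNN -invrN; apply: divr_ge0; lra.
  by apply: divr_ge0; lra.
exists (p + t i *: kappa); split; first exact: same_proj_add.
apply/(faces_at_points _ card3 vc); split; last first.
  by exists i; rewrite // !mxE tE // addrC subrK.
apply/cell_pointsP => j; rewrite !mxE; have [jc|jc] := boolP (j \in c.2); last first.
  by move: (pc j); rewrite (kappa_supp jc) (negbTE jc) mulr0 !addr0.
have le_t : t i <= t j by exact: mini.
move: (pc j) (tE j jc); rewrite jc /= => /andP[p1 p2] tjE.
case: (kappa_sign jc) => [[Ev k0]|[Ev k0]]; rewrite Ev in tjE.
  have ti_le0 : t i * kappa ord0 j <= 0 by rewrite mulr_ge0_le0 // ltW.
  have tj_le_ti : t j * kappa ord0 j <= t i * kappa ord0 j by rewrite ler_nM2r.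
  by apply/andP; split; rewrite /=; lra.
have ti_ge0 : 0 <= t i * kappa ord0 j by rewrite mulr_ge0 // ltW.
have ti_le_tj : t i * kappa ord0 j <= t j * kappa ord0 j by rewrite ler_pM2r.
by apply/andP; split; rewrite /=; lra.
Qed.

Let beyond_facet p q t i : cell_points c p -> i \in c.2 ->
  q ord0 i = (v ord0 i)%:~R -> p - q = t *: kappa -> t <= 0.
Proof.
move=> /cell_pointsP/(_ i) + ic qi pq; rewrite ic /= => /andP[p1 p2].
have pE : p ord0 i = (v ord0 i)%:~R + t * kappa ord0 i.
  by rewrite -qi -[p](subrK q) pq !mxE addrC.
rewrite leNgt; apply/negP => t_gt0.
have [[Ev k0]|[Ev k0]] := kappa_sign ic; rewrite Ev in pE.
  have : t * kappa ord0 i < 0 by rewrite pmulr_rlt0.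
  by lra.
have : 0 < t * kappa ord0 i by rewrite pmulr_rgt0.
by lra.
Qed.

Lemma faces_at_inj p q : @realization R n (faces_at c v) p ->
  @realization R n (faces_at c v) q -> same_proj p q -> p = q.
Proof.
move=> /(faces_at_points _ card3 vc)[pc [i ic pi]].
move=> /(faces_at_points _ card3 vc)[qc [i' ic' qi]].
move=> [ex ey]; have [||t pqE] := @fibre_direction_span (p - q).
- move=> j jc; rewrite !mxE; move/cell_pointsP: pc => /(_ j).
  move/cell_pointsP: qc => /(_ j); rewrite (negbTE jc) !addr0 -!eq_le.
  by move=> /eqP <- /eqP <-; rewrite subrr.
- by split; rewrite linearB /= ?ex ?ey subrr linear0.
have t_le0 := beyond_facet pc ic' qi pqE.
have qpE : q - p = - t *: kappa by rewrite -opprB pqE scaleNr.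
have t_ge0 := beyond_facet qc ic pi qpE.
have t0 : t = 0 by lra.
by apply/eqP; rewrite -subr_eq0 pqE t0 scale0r.
Qed.

Definition inward p := forall i, i \in c.2 ->
  if v ord0 i == c.1 ord0 i then 0 <= p ord0 i else p ord0 i <= 0.

Lemma inward_representative delta :
  exists eta, [/\ supported c.2 eta, inward eta & same_proj eta delta].
Proof.
have /card_gt1P[j [k [jc kc jk]]] : (1 < #|c.2|)%N by rewrite card3.
have [eta [eta_supp etax etay]] := lin2_surj v_fan (lin vx delta) (lin vy delta) jk.
pose M := \sum_(i in c.2) `|eta ord0 i / kappa ord0 i|.
have leM i : i \in c.2 -> `|eta ord0 i| <= M * `|kappa ord0 i|.
  move=> ic; rewrite -ler_pdivrMr ?normr_gt0 ?kappa_neq0 // -normfV -normrM.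
  by rewrite /M (bigD1 i) //= lerDl sumr_ge0.
exists (eta + (- M) *: kappa); split; last exact: same_proj_trans (same_proj_add _ _) _.
  move=> i ic; rewrite !mxE kappa_supp // mulr0 addr0 eta_supp //.
  by rewrite !inE negb_or; apply/andP; split; apply: contraNneq ic => ->.
move=> i ic; have := leM i ic; rewrite ler_norml !mxE mulNr => /andP[].
case: kappa_fibre => /(_ i ic) + _ _; case: ifP => _ k0.
  by rewrite (ltr0_norm k0); lra.
by rewrite (gtr0_norm k0); lra.
Qed.

Lemma inward_small eta : supported c.2 eta -> inward eta ->
  exists2 eps : R, 0 < eps < 1 & cell_points c (intv v + eps *: eta).
Proof.
move=> eta_supp eta_in; pose B := 2 + \sum_(i in c.2) `|eta ord0 i|.
have B_ge2 : 2 <= B by rewrite lerDl sumr_ge0.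
have leB i : i \in c.2 -> `|eta ord0 i| <= B.
  by move=> ic; rewrite /B (bigD1 i) //= addrCA lerDl addr_ge0 // sumr_ge0.
have B_gt0 : 0 < B by lra.
exists B^-1; first by rewrite invr_gt0 B_gt0 invf_lt1 //; lra.
apply/cell_pointsP => i; rewrite !mxE; have [ic|ic] := boolP (i \in c.2); last first.
  rewrite eta_supp // mulr0 !addr0.
  by move: (op i); rewrite (negbTE ic) => /andP[/eqP -> _]; rewrite lexx.
have : `|B^-1 * eta ord0 i| <= 1.
  by rewrite normrM normfV (gtr0_norm B_gt0) ler_pdivrMl // mulr1 leB.
rewrite ler_norml => /andP[z1 z2]; move: (op i) (eta_in i ic); rewrite ic.
case: eqP => [-> _|_ /= /andP[/eqP -> _]] eta_i.
  have : 0 <= B^-1 * eta ord0 i by rewrite mulr_ge0 // invr_ge0 ltW.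
  by rewrite /=; move: z1 z2; lra.
have : B^-1 * eta ord0 i <= 0 by rewrite mulr_ge0_le0 // invr_ge0 ltW.
by rewrite intrD /=; move: z1 z2; lra.
Qed.

(* The point v projects to an interior point of the hexagon. *)
Lemma faces_at_neighbourhood (delta : 'rV[R]_n) :
  exists2 eps : R, 0 < eps < 1 &
    exists q, same_proj q (intv v + eps *: delta) /\ @realization R n (faces_at c v) q.
Proof.
have [eta [eta_supp eta_in eta_proj]] := inward_representative delta.
have [eps eps01 eps_in] := inward_small eta_supp eta_in; exists eps => //.
have [q [q_proj qv]] := push_to_faces eps_in; exists q; split=> //.
apply: same_proj_trans q_proj _; apply: same_projD => //; exact: same_projZ.
Qed.

End CubeProjection.

End FibreDirections.

Section Tilings.
Variables (R : realType) (n : nat) (theta : 'I_n -> R).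
Implicit Types (p q r : 'rV[R]_n) (i : 'I_n).

Definition abscissa i : R := cos (theta i).
Definition ordinate i : R := sin (theta i).

Lemma angles_fan : (forall i, 0 < theta i < pi) ->
  (forall i j : 'I_n, (i < j)%N -> theta i < theta j) -> fan abscissa ordinate.
Proof.
move=> bounds incr; split=> [i|i j ij]; first exact: sin_gt0_pi.
have := incr i j ij; move: (bounds i) (bounds j) => /andP[i0 i1] /andP[j0 j1] lt.
rewrite /cross /abscissa /ordinate [X in X - _]mulrC [X in _ - X]mulrC -sinB.
by apply: sin_gt0_pi; lra.
Qed.

Local Notation same_proj := (same_proj abscissa ordinate).

Lemma same_projE p q : same_proj p q <-> Defs.proj theta p = Defs.proj theta q.
Proof. by split=> [[ex ey]|[]//]; congr pair. Qed.

Section TilingBasics.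
Variables (a : 'I_n -> nat) (T : set (cell n)).
Hypothesis tT : tiling a theta T.
Implicit Types c d : cell n.

Lemma tiling_box c : T c -> in_box a c.
Proof. by case: tT => -[+ _] _; exact. Qed.

Lemma tiling_closed : face_closed T.
Proof. by case: tT => -[_ +] _; exact. Qed.

Lemma tiling_dim c : T c -> (#|c.2| <= 2)%N.
Proof. by case: tT => _ [[+ _] _]; exact. Qed.

Lemma tiling_inj p q : @realization R n T p -> @realization R n T q ->
  same_proj p q -> p = q.
Proof.
move=> rp rq /same_projE pq; case: tT => _ [_ [[_ inj _] _]].
by apply: inj => //; exact: mem_set.
Qed.

Lemma tiling_surj p : @box R n a p -> exists q, @realization R n T q /\ same_proj q p.
Proof.
move=> bp; case: tT => _ [_ [[_ _ surj] _]].
have [|q rq qp] := surj (Defs.proj theta p); first by exists p.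
by exists q; split=> //; apply/same_projE.
Qed.

Lemma tiling_near q (delta : R) : @realization R n T q -> 0 < delta ->
  exists2 eps : R, 0 < eps & forall p, @box R n a p ->
    `|lin abscissa q - lin abscissa p| < eps ->
    `|lin ordinate q - lin ordinate p| < eps ->
    exists r, [/\ @realization R n T r, same_proj r p &
                  forall i, `|q ord0 i - r ord0 i| < delta].
Proof.
move=> rq d_gt0; case: tT => _ [_ [[fP inj _] [_ [g [gf gc]]]]].
have [eps e_gt0 near_q] := within_continuous_coord gc (fP _ rq) d_gt0.
exists eps => // p bp px py; have [r [rr rp]] := tiling_surj bp.
have /same_projE projr := rp; exists r; split=> // i.
have := near_q (Defs.proj theta p); rewrite gf // -projr gf //; apply=> //.
- by rewrite projr; exists p.
- by rewrite projr.
- by rewrite projr.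
Qed.

End TilingBasics.

Section FlipTiling.
Variables (a : 'I_n -> nat) (T : set (cell n)).
Variables (c : cell n) (v w : 'rV[int]_n) (kappa : 'rV[R]_n).
Hypothesis v_fan : fan abscissa ordinate.
Hypothesis card3 : #|c.2| = 3%N.
Hypothesis op : opposite c v w.
Hypothesis kappa_fibre : fibre_direction abscissa ordinate c v kappa.
Hypothesis cbox : in_box a c.
Hypothesis tT : tiling a theta T.
Hypothesis sub : faces_at c v `<=` T.
Implicit Type d : cell n.
Local Notation T' := ((T `\` faces_at c v) `|` faces_at c w).
Local Notation intv := (map_mx (intr : int -> R)).

Let op' : opposite c w v. Proof. exact: opposite_sym. Qed.
Let vc : face_of (vertex v) c. Proof. exact: opposite_vertex op. Qed.
Let wc : face_of (vertex w) c. Proof. exact: opposite_vertex op'. Qed.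

Let kappa_fibre' : fibre_direction abscissa ordinate c w (- kappa).
Proof. exact: fibre_direction_opposite op kappa_fibre. Qed.

Let realization_sub p : @realization R n (faces_at c v) p -> @realization R n T p.
Proof. by move=> [d [/sub Td pd]]; exists d. Qed.

Lemma star_faces_at d : T d -> face_of (vertex v) d -> faces_at c v d.
Proof.
move=> Td /vertex_faceP vd.
pose delta : 'rV[R]_n := \row_i
  if i \in d.2 then if v ord0 i == d.1 ord0 i then 1 else -1 else 0.
have [eps /andP[e0 e1] [q [q_proj qv]]] :=
  faces_at_neighbourhood v_fan card3 op kappa_fibre delta.
have dE : carrier (intv v + eps *: delta) = d.
  apply: carrier_eq => i; rewrite /delta !mxE; move: (vd i); case: ifP => [id|id] /=.
    have [Ev _|ne vd'] := eqVneq (v ord0 i) (d.1 ord0 i).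
      by rewrite id Ev intrD mulr1; apply/andP; split; lra.
    rewrite id; have -> : v ord0 i = d.1 ord0 i + 1 by lia.
    by rewrite intrD mulrN1; apply/andP; split; lra.
  by rewrite addr0 => vd'; rewrite id mulr0 addr0 eqr_int; lia.
have pT : @realization R n T (intv v + eps *: delta).
  by apply/(realization_carrier _ (tiling_closed tT)); rewrite dE.
have qE := tiling_inj tT (realization_sub qv) pT q_proj; rewrite qE in qv.
by move: qv=> /(realization_carrier _ (@faces_at_closed _ _ _)); rewrite dE.
Qed.

Lemma opposite_vertex_notin : ~ T (vertex w).
Proof.
move=> Tw; have wc' := face_points wc (@vertex_points R n w).
have [q [qw qv]] := push_to_faces card3 op kappa_fibre wc'.
have rw : @realization R n T (intv w).
  by exists (vertex w); split=> //; exact: vertex_points.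
have qE := tiling_inj tT (realization_sub qv) rw qw; rewrite qE in qv.
move: qv=> /(faces_at_points _ card3 vc)[_ [i ic]].
by rewrite mxE => /eqP; rewrite eqr_int; move: (op i); rewrite ic; lia.
Qed.

Lemma flip_kept d : T d -> ~ face_of (vertex v) d -> T' d.
Proof.
move=> Td vd; have [fd|fd] := pselect (faces_at c v d); last by left.
right; apply: faces_at_opposite vd => //.
by case/(faces_atP _ card3 vc): fd.
Qed.

Lemma flip_old d : T' d -> ~ faces_at c w d -> T d /\ ~ face_of (vertex v) d.
Proof. by move=> [[Td fd] _|//]; split=> // vd; apply: fd; exact: star_faces_at. Qed.

Let flip_closed : face_closed T'.
Proof.
move=> d d' T'd d'd; have [fd|fd] := pselect (faces_at c w d).
  by right; apply: faces_at_closed d'd.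
have [Td vd] := flip_old T'd fd; apply: flip_kept;
  first exact: tiling_closed tT _ _ _ d'd.
by move=> vd'; apply: vd; exact: face_of_trans d'd.
Qed.

Let flip_box d : T' d -> in_box a d.
Proof.
move=> [[/(tiling_box tT)//]|/(faces_atP _ card3 wc)[dc _]].
exact: in_box_face dc.
Qed.

Let flip_two_dimensional : two_dimensional T'.
Proof.
split=> [d [[/(tiling_dim tT)//]|[f [_ <- _ [/subset_leq_card]]]]//|].
have [i ic] : exists i, i \in c.2 by apply/card_gt0P; rewrite card3.
exists (facet c w i); split; first by right; exact: facet_in_faces_at.
by apply: succn_inj; rewrite -card3 (card_facet w ic).
Qed.

Let realization_flip p : @realization R n T' p -> @realization R n (faces_at c w) p \/
  @realization R n T p /\ ~ face_of (vertex v) (carrier p).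
Proof.
move=> /(realization_carrier _ flip_closed) T'p.
have [fp|fp] := pselect (faces_at c w (carrier p)).
  by left; apply/(realization_carrier _ (@faces_at_closed _ _ _)).
have [Tp vp] := flip_old T'p fp.
by right; split=> //; apply/(realization_carrier _ (tiling_closed tT)).
Qed.

Let new_old_inj p q : @realization R n (faces_at c w) p -> @realization R n T q ->
  ~ face_of (vertex v) (carrier q) -> same_proj p q -> p = q.
Proof.
move=> pw Tq vq pq; have [pc _] := (faces_at_points p card3 wc).1 pw.
have [p' [p'p p'v]] := push_to_faces card3 op kappa_fibre pc.
have p'q := tiling_inj tT (realization_sub p'v) Tq (same_proj_trans p'p pq).
rewrite p'q in p'v; have [qc _] := (faces_at_points q card3 vc).1 p'v.
apply: (faces_at_inj v_fan card3 op' kappa_fibre') => //.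
apply/(realization_carrier _ (@faces_at_closed _ _ _)).
by apply: faces_at_opposite vq => //; exact: carrier_face.
Qed.

Let flip_inj p q : @realization R n T' p -> @realization R n T' q ->
  same_proj p q -> p = q.
Proof.
move=> /realization_flip[pw|[Tp vp]] /realization_flip[qw|[Tq vq]] pq.
- exact: (faces_at_inj v_fan card3 op' kappa_fibre').
- exact: new_old_inj.
- by apply/esym; apply: new_old_inj => //; exact: same_proj_sym.
- exact: (tiling_inj tT).
Qed.

Let flip_surj p : @box R n a p -> exists q, @realization R n T' q /\ same_proj q p.
Proof.
move=> bp; have [q [rq qp]] := tiling_surj tT bp.
have Tq := (realization_carrier _ (tiling_closed tT)).1 rq.
have [vq|vq] := pselect (face_of (vertex v) (carrier q)); last first.
  by exists q; split=> //; apply/(realization_carrier _ flip_closed); exact: flip_kept.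
have [qc _] := (faces_atP _ card3 vc).1 (star_faces_at Tq vq).
have [q' [q'q [d [fd q'd]]]] := push_to_faces card3 op' kappa_fibre'
  (face_points qc (carrier_points q)).
exists q'; split; last exact: same_proj_trans q'q qp.
by exists d; split=> //; right.
Qed.

Lemma flip_tiling : tiling a theta T'.
Proof.
split; first by split; [exact: flip_box|exact: flip_closed].
split; first exact: flip_two_dimensional.
apply: (homeomorphism_on_realization flip_box); split.
- by move=> p [d [/flip_box bd pd]]; exists p => //; exact: in_box_points bd pd.
- by move=> p q /set_mem T'p /set_mem T'q /same_projE; exact: flip_inj.
- by move=> _ [p /flip_surj[q [T'q /same_projE qp]] <-]; exists q.
Qed.

End FlipTiling.

End Tilings.

(** * Paths in a tiling *)

Section Words.
Variable n : nat.
Implicit Types (c d : cell n) (V : 'rV[int]_n) (T : set (cell n)).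
Implicit Types (i j k : 'I_n) (u w z : seq 'I_n) (a : 'I_n -> nat).
Local Notation e := (@basis_vec n).

Definition full a w := forall i, count_mem i w = a i.

Lemma full_swap a u j k z : full a (u ++ j :: k :: z) -> full a (u ++ k :: j :: z).
Proof. by move=> fw i; rewrite -(fw i) !count_cat /=; lia. Qed.

Lemma full_count a w u j z i : full a w -> w = u ++ j :: z ->
  a i = (count_mem i u + (i == j) + count_mem i z)%N.
Proof. by move=> fw wE; rewrite -(fw i) wE count_cat /= addnA [j == i]eq_sym. Qed.

Lemma not_sorted_ascent w : ~~ sorted >=%O w ->
  exists u j k z,
    [/\ w = u ++ j :: k :: z, (j < k)%N & forall i, i \in u -> (j <= i)%N].
Proof.
case: w => // j w; elim: w j => //= k w IH j; rewrite negb_and.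
case: (boolP (k <= j)%O) => /= [kj /IH|]; last first.
  by rewrite -ltNge ltEord => jk _; exists [::], j, k, w.
move=> [u [j' [k' [z [wE jk lo]]]]]; exists (j :: u), j', k', z; rewrite wE;
  split=> // i.
rewrite inE => /predU1P[->|/lo//]; rewrite leEord in kj; apply: leq_trans kj.
by case: u wE lo => [[->]|i' u [-> _]] // /(_ i'); rewrite inE eqxx; exact.
Qed.

Fixpoint path_in T V w :=
  if w is j :: w' then T (V, [set j]%SET) /\ path_in T (V + e j) w' else True.

Lemma path_in_cat T V u z :
  path_in T V (u ++ z) <-> path_in T V u /\ path_in T (V + endpoint u) z.
Proof.
elim: u V => [|j u IH] V /=; first by rewrite endpoint_nil addr0; split=> [|[]].
by rewrite IH endpoint_cons addrA; split=> [[? []]|[[]]].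
Qed.

Lemma path_inP T w : path_in T 0 w <->
  forall u j z, w = u ++ j :: z -> T (endpoint u, [set j]%SET).
Proof.
split=> [pw u j z wE|]; first by move: pw; rewrite wE => /path_in_cat[_];
  rewrite add0r => -[].
move=> edges; suff suffix u z : w = u ++ z -> path_in T (endpoint u) z.
  by have := suffix [::] w erefl; rewrite endpoint_nil.
elim: z u => [//|j z IH] u wE /=; split; first exact: edges wE.
by rewrite -endpoint_rcons; apply: IH; rewrite cat_rcons.
Qed.

Lemma tile_edge_low V j k : face_of (V, [set j]%SET) (V, [set j; k]%SET).
Proof.
split=> /= [|i]; first exact: finset.subsetUl.
by rewrite lexx lerDl.
Qed.

Lemma tile_edge_high V j k : j != k ->
  face_of (V + e k, [set j]%SET) (V, [set j; k]%SET).
Proof.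
move=> jk; split=> /= [|i]; first exact: finset.subsetUl.
rewrite coord_add_basis !inE; have [->|ik] := eqVneq i k;
  last by rewrite addr0 lexx lerDl.
by rewrite eq_sym (negbTE jk) /=; lia.
Qed.

Lemma path_in_swap T u j k z : face_closed T -> j != k ->
  path_in T 0 (u ++ j :: k :: z) -> T (endpoint u, [set j; k]%SET) ->
  path_in T 0 (u ++ k :: j :: z).
Proof.
move=> Tf jk /path_in_cat[uT]; rewrite add0r => -[_ [_ zT]] Tt.
apply/path_in_cat; rewrite add0r; split=> //=; split.
  by apply: Tf Tt _; rewrite finset.setUC; exact: tile_edge_low.
by split; [apply: Tf Tt _; exact: tile_edge_high|rewrite addrAC].
Qed.

End Words.

Lemma near0_scale_lt (R : realFieldType) (x eps : R) : 0 < eps ->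
  \forall t \near 0^'+, `|t * x| < eps.
Proof.
move=> eps_gt0; have d_gt0 : 0 < eps / (1 + `|x|) by rewrite divr_gt0 // ltr_pwDl.
near=> t; have t_ge0 : 0 <= t by near: t; exact: nbhs_right_ge.
have : t < eps / (1 + `|x|) by near: t; exact: nbhs_right_lt.
rewrite ltr_pdivlMr ?ltr_pwDl // normrM (ger0_norm t_ge0); apply: le_lt_trans.
by rewrite mulrDr mulr1 lerDr.
Unshelve. all: by end_near. Qed.

Section LeftTiles.
Variables (R : realType) (n : nat) (a : 'I_n -> nat) (theta : 'I_n -> R).
Local Notation vx := (abscissa theta).
Local Notation vy := (ordinate theta).
Local Notation cross := (cross vx vy).
Hypothesis v_fan : fan vx vy.
Variable T : set (cell n).
Hypothesis tT : tiling a theta T.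
Implicit Types (p q r delta : 'rV[R]_n) (V : 'rV[int]_n) (b i j k m : 'I_n).
Implicit Types (u w z : seq 'I_n).
Local Notation e := (@basis_vec n).
Local Notation E i := (delta_mx ord0 i : 'rV[R]_n).
Local Notation intv := (map_mx (intr : int -> R)).

Lemma box_feasible_direction q delta : @box R n a q ->
  (forall i, delta ord0 i < 0 -> 0 < q ord0 i) ->
  (forall i, 0 < delta ord0 i -> q ord0 i < (a i)%:R) ->
  \forall t \near 0^'+, @box R n a (q + t *: delta).
Proof.
move=> bq lo hi; apply: filter_forall => i; have /andP[q0 qa] := bq i.
have [d0|d0|d0] := ltgtP (delta ord0 i) 0; last first.
- by near=> t; rewrite !mxE d0 mulr0 addr0; exact: bq.
- near=> t; have t_ge0 : 0 <= t by near: t; exact: nbhs_right_ge.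
  have td : 0 <= t * delta ord0 i by rewrite mulr_ge0 // ltW.
  have : `|t * delta ord0 i| < (a i)%:R - q ord0 i.
    by near: t; apply: near0_scale_lt; rewrite subr_gt0 hi.
  by rewrite !mxE ger0_norm // => lt; apply/andP; split; lra.
- near=> t; have t_ge0 : 0 <= t by near: t; exact: nbhs_right_ge.
  have td : t * delta ord0 i <= 0 by rewrite mulr_ge0_le0 // ltW.
  have : `|t * delta ord0 i| < q ord0 i by near: t; apply: near0_scale_lt; exact: lo.
  by rewrite !mxE ler0_norm // => lt; apply/andP; split; lra.
Unshelve. all: by end_near. Qed.

(* The edge (V, {b}) is not on the left boundary of the zonogon. *)
Definition left_free V b :=
  (exists m, (b < m)%N /\ V ord0 m < (a m)%:Z) \/ (exists m, (m < b)%N /\ 0 < V ord0 m).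

Definition has_left_tile V b :=
  (exists m, (b < m)%N /\ T (V, [set b; m]%SET)) \/
  (exists m, (m < b)%N /\ T (V - e m, [set m; b]%SET)).

Section NearEdge.
Variables (V : 'rV[int]_n) (b : 'I_n).
Local Notation q := (center R (V, [set b]%SET)).

Let centerE i : q ord0 i = (V ord0 i)%:~R + (i == b)%:R / 2.
Proof. by rewrite mxE /= inE. Qed.

Lemma edge_left_direction : in_box a (V, [set b]%SET) -> left_free V b ->
  exists delta, [/\ lin vx delta = -1, lin vy delta = 0 &
    \forall t \near 0^'+, @box R n a (q + t *: delta)].
Proof.
move=> Vbox free; have bq := in_box_points Vbox (center_points R (V, [set b]%SET)).
have [m [bm hi lo]] : exists m, [/\ b != m,
    0 < cross b m -> V ord0 m < (a m)%:Z & cross b m < 0 -> 0 < V ord0 m].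
  case: free => -[m [lt Vm]]; exists m; have [nbm nmb] := ord_lt_neq lt.
    split=> //; first by rewrite nbm.
    by rewrite ltNge ltW // fan_cross_gt0.
  split=> //; first by rewrite nmb.
  by rewrite crossC oppr_gt0 ltNge ltW // fan_cross_gt0.
have [delta [sd dx dy]] := lin2_surj v_fan (-1) 0 bm; exists delta; split=> //.
have dm : 0 < delta ord0 m * cross b m.
  by apply: (cross_leftward v_fan); rewrite // dx ltrN10.
have Vb : 0 <= (V ord0 b)%:~R :> R /\ (V ord0 b)%:~R + 1 <= (a b)%:R :> R.
  by case: (Vbox b) => /=; rewrite inE eqxx -(ler_int R) -(ler_int R) intrD.
apply: box_feasible_direction => // i di; rewrite centerE.
all: have [->|ib] := eqVneq i b; first by case: Vb => Vb0 Vb1 /=; lra.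
all: have im : i = m by apply/eqP; apply: contraTT di => im;
  rewrite sd ?ltxx // !inE negb_or ib.
all: rewrite im /= mul0r addr0 in di *.
  by rewrite ltr0z; apply: lo; rewrite nmulr_rgt0 in dm.
by rewrite -[(a m)%:R]/((a m)%:Z%:~R) ltr_int; apply: hi; rewrite pmulr_rgt0 in dm.
Qed.

Variable r : 'rV[R]_n.
Hypothesis near_r : forall i, `|q ord0 i - r ord0 i| < 1 / 2.

Lemma near_edge_mem : b \in (carrier r).2.
Proof.
apply: (@mem_carrier _ _ _ _ (V ord0 b)); move: (near_r b).
by rewrite centerE eqxx intrD ltr_norml /= => /andP[h1 h2]; apply/andP; split; lra.
Qed.

Let near_r_off i : i != b -> - (1 / 2) < r ord0 i - (V ord0 i)%:~R < 1 / 2.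
Proof.
move=> /negbTE ib; have := near_r i.
by rewrite centerE ib mul0r addr0 distrC ltr_norml.
Qed.

Let displacementE i : i != b -> (r - q) ord0 i = r ord0 i - (V ord0 i)%:~R.
Proof. by move=> /negbTE ib; rewrite mxE mxE centerE ib mul0r addr0. Qed.

Lemma near_edge_mem_off i : i != b -> (r - q) ord0 i != 0 -> i \in (carrier r).2.
Proof.
move=> ib; rewrite displacementE // neq_lt; have /andP[h1 h2] := near_r_off ib.
case/orP => [lt0|gt0].
  apply: (@mem_carrier _ _ _ _ (V ord0 i - 1)).
  by rewrite subrK intrB; apply/andP; split; lra.
by apply: (@mem_carrier _ _ _ _ (V ord0 i)); rewrite intrD; apply/andP; split; lra.
Qed.

Lemma near_edge_tile m : m != b -> supported [set b; m] (r - q) ->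
  (0 < (r - q) ord0 m -> carrier r = (V, [set b; m]%SET)) /\
  ((r - q) ord0 m < 0 -> carrier r = (V - e m, [set m; b]%SET)).
Proof.
move=> mb sd; rewrite displacementE //; have /andP[h1 h2] := near_r_off mb.
have r_b : (V ord0 b)%:~R < r ord0 b < (V ord0 b + 1)%:~R.
  move: (near_r b); rewrite centerE eqxx intrD ltr_norml /= => /andP[g1 g2].
  by apply/andP; split; lra.
have r_o i : i != b -> i != m -> r ord0 i = (V ord0 i)%:~R.
  move=> ib im; apply/eqP; rewrite -subr_eq0 -displacementE // sd //.
  by rewrite !inE negb_or ib.
split=> sgn; apply: carrier_eq => i; rewrite !inE ?coord_sub_basis.
  have [->|ib] := eqVneq i b => //=.
  have [->|im] := eqVneq i m => /=; last by rewrite r_o.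
  by rewrite intrD; apply/andP; split; lra.
have [->|im] := eqVneq i m => /=.
  by rewrite subrK intrB; apply/andP; split; lra.
by rewrite subr0; have [->|ib] := eqVneq i b => //=; rewrite r_o.
Qed.

Lemma left_displacement_tile : @realization R n T r ->
  lin vx (r - q) < 0 -> lin vy (r - q) = 0 -> has_left_tile V b.
Proof.
move=> /(realization_carrier _ (tiling_closed tT)) Tr dx dy.
have [m mb dm] : exists2 m, m != b & (r - q) ord0 m != 0.
  apply: contrapT => no; suff rq0 : r - q = 0 by rewrite rq0 linear0 ltxx in dx.
  have sb : supported [set b] (r - q).
    move=> i; rewrite inE => ib; apply/eqP; apply: contrapT => /negP di.
    by apply: no; exists i.
  by rewrite (supported1 sb) in dy *; rewrite (horizontal_delta v_fan dy) scale0r.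
have carrierE : (carrier r).2 = [set b; m]%SET.
  apply/esym/eqP; rewrite eqEcard finset.subUset !finset.sub1set near_edge_mem.
  by rewrite near_edge_mem_off //= cards2 eq_sym mb; exact: tiling_dim tT _ Tr.
have sd : supported [set b; m] (r - q).
  move=> i; rewrite -carrierE => ic; have [ib|ib] := eqVneq i b.
    by rewrite ib near_edge_mem in ic.
  by apply/eqP; apply: contraNT ic; exact: near_edge_mem_off.
have := cross_leftward v_fan _ sd dy dx; rewrite eq_sym mb => /(_ isT) signs.
have [tile_gt tile_lt] := near_edge_tile mb sd.
case: (ltngtP b m) => [bm|mb'|/ord_inj bm]; last by rewrite bm eqxx in mb.
  left; exists m; split=> //; rewrite -tile_gt //.
  by rewrite pmulr_lgt0 ?fan_cross_gt0 in signs.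
right; exists m; split=> //; rewrite -tile_lt //.
by move: signs; rewrite crossC mulrN -mulNr pmulr_lgt0 ?oppr_gt0 ?fan_cross_gt0.
Qed.

End NearEdge.

Lemma left_tile V b : T (V, [set b]%SET) -> left_free V b -> has_left_tile V b.
Proof.
move=> Tb free; set q := center R (V, [set b]%SET).
have rq : @realization R n T q.
  by exists (V, [set b]%SET); split=> //; exact: center_points.
have [delta [dx dy dbox]] := edge_left_direction (tiling_box tT Tb) free.
have half_gt0 : 0 < 1 / 2 :> R by lra.
have [eps eps_gt0 near_q] := tiling_near tT rq half_gt0.
have [t [t_gt0 t_eps t_box]] : exists t : R,
    [/\ 0 < t, t < eps & @box R n a (q + t *: delta)].
  near (0 : R)^'+ => t; exists t; split; near: t => //.
    exact: nbhs_right_gt.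
  exact: nbhs_right_lt.
have xE : lin vx (q + t *: delta) = lin vx q - t.
  by rewrite linearD linearZ /= dx mulrN1.
have yE : lin vy (q + t *: delta) = lin vy q.
  by rewrite linearD linearZ /= dy mulr0 addr0.
have [||r [rr [rx ry] near_r]] := near_q _ t_box.
- by rewrite xE opprB addrC subrK gtr0_norm.
- by rewrite yE subrr normr0.
apply: left_displacement_tile near_r rr _ _.
  by rewrite linearB /= rx xE addrC addKr oppr_lt0.
by rewrite linearB /= ry yE subrr.
Unshelve. all: by end_near. Qed.

Lemma left_wedge V j k : (j < k)%N -> exists delta,
  [/\ supported [set j; k] delta, delta ord0 j < 0 < delta ord0 k,
      lin vx delta = -1, lin vy delta = 0 &
      \forall t \near 0^'+,
        cell_points (V - e j, [set j; k]%SET) (intv V + t *: delta)].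
Proof.
move=> jk; have [njk nkj] := ord_lt_neq jk.
have [delta [sd dx dy]] := lin2_surj v_fan (-1) 0 (negbT njk).
have dk : 0 < delta ord0 k.
  have := cross_leftward v_fan (negbT njk) sd dy; rewrite dx ltrN10 => /(_ isT).
  by rewrite pmulr_lgt0 ?fan_cross_gt0.
have dj : delta ord0 j < 0.
  rewrite finset.setUC in sd; have := cross_leftward v_fan (negbT nkj) sd dy.
  rewrite dx ltrN10 crossC => /(_ isT).
  by rewrite mulrN -mulNr pmulr_lgt0 ?oppr_gt0 ?fan_cross_gt0.
exists delta; split=> //; first by rewrite dj.
near=> t; have t_ge0 : 0 <= t by near: t; exact: nbhs_right_ge.
have : `|t * delta ord0 j| < 1 by near: t; exact: near0_scale_lt.
have : `|t * delta ord0 k| < 1 by near: t; exact: near0_scale_lt.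
rewrite (ger0_norm (mulr_ge0 t_ge0 (ltW dk))) (ler0_norm (mulr_ge0_le0 t_ge0 (ltW dj))).
move=> tk tj; have tk0 := mulr_ge0 t_ge0 (ltW dk);
  have tj0 := mulr_ge0_le0 t_ge0 (ltW dj).
apply/cell_pointsP => i; rewrite coord_sub_basis intrB !inE !mxE.
have [->|ij] := eqVneq i j; first by rewrite njk /=; apply/andP; split; lra.
have [->|ik] := eqVneq i k => /=; first by apply/andP; split; lra.
by rewrite sd ?mulr0 ?subr0 ?addr0 ?lexx // !inE negb_or ij.
Unshelve. all: by end_near. Qed.

(* Both tiles contain a horizontal segment going left from V. *)
Lemma left_tiles_eq V b m m' b' :
  (b < m)%N -> T (V - e b, [set b; m]%SET) ->
  (m' < b')%N -> T (V - e m', [set m'; b']%SET) -> b = m' /\ m = b'.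
Proof.
move=> bm Tbm mb Tmb.
have [delta [sd /andP[db dm] dx dy near_d]] := left_wedge V bm.
have [delta' [sd' /andP[dm' db'] dx' dy' near_d']] := left_wedge V mb.
have dE : delta = delta'.
  have [t [t_gt0 td td']] : exists t : R, [/\ 0 < t,
      cell_points (V - e b, [set b; m]%SET) (intv V + t *: delta) &
      cell_points (V - e m', [set m'; b']%SET) (intv V + t *: delta')].
    near (0 : R)^'+ => t; exists t; split; near: t => //; exact: nbhs_right_gt.
  have : intv V + t *: delta = intv V + t *: delta'.
    apply: (tiling_inj tT); first by exists (V - e b, [set b; m]%SET).
      by exists (V - e m', [set m'; b']%SET).
    by apply: same_projD => //; apply: same_projZ; split; rewrite ?dx ?dx' ?dy ?dy'.
  by move=> /addrI/(scalerI (lt0r_neq0 t_gt0)).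
have only2 i : delta ord0 i != 0 -> i = b \/ i = m.
  move=> di; have : i \in [set b; m]%SET by apply: contraNT di => /sd ->.
  by rewrite !inE => /orP[] /eqP ->; [left|right].
split.
  case: (only2 m') => [|//|m'm]; first by rewrite dE lt_eqF.
  by move: dm; rewrite -m'm dE ltNge ltW.
case: (only2 b') => [|b'b|//]; first by rewrite dE gt_eqF.
by move: db; rewrite -b'b dE ltNge ltW.
Unshelve. all: by end_near. Qed.

End LeftTiles.

Section Ascents.
Variables (R : realType) (n : nat) (a : 'I_n -> nat) (theta : 'I_n -> R).
Local Notation vx := (abscissa theta).
Local Notation vy := (ordinate theta).
Hypothesis v_fan : fan vx vy.
Variable T : set (cell n).
Hypothesis tT : tiling a theta T.
Implicit Types (i j k m : 'I_n) (u z : seq 'I_n).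
Local Notation e := (@basis_vec n).

Definition has_tiled_ascent w := exists u j k z,
  [/\ w = u ++ j :: k :: z, (j < k)%N & T (endpoint u, [set j; k]%SET)].

Variable w : seq 'I_n.
Hypothesis fw : full a w.
Hypothesis pw : path_in T 0 w.

Let edge u j z : w = u ++ j :: z -> T (endpoint u, [set j]%SET).
Proof. exact: (path_inP T w).1. Qed.

(* Walking up w from the edge j: the next edge k has a left tile, which is
   either the given tile, and then m = k, or a tile {k, m'} with k < m'. *)
Lemma ascent_above u j z m : w = u ++ j :: z -> (j < m)%N ->
  T (endpoint u, [set j; m]%SET) -> has_tiled_ascent w.
Proof.
elim: z u j m => [|k z IH] u j m wE jm Tt.
  have := full_count m fw wE; have [_ ->] := ord_lt_neq jm.
  by case: (tiling_box tT Tt m) => /=; rewrite endpoint_coord !inE eqxx orbT /=; lia.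
have wE' : w = rcons u j ++ k :: z by rewrite wE cat_rcons.
have free : left_free a (endpoint (rcons u j)) k.
  have [km|mk] := ltnP k m; [left; exists m|right; exists j]; split=> //.
  - have [_ mj] := ord_lt_neq jm; case: (tiling_box tT Tt m) => /= _.
    by rewrite endpoint_rcons coord_add_basis mj !inE eqxx orbT; lia.
  - exact: leq_trans mk.
  - by rewrite endpoint_rcons coord_add_basis eqxx endpoint_coord; lia.
case: (left_tile v_fan tT (edge wE') free) => -[m' [lt T']]; first exact: IH wE' lt T'.
have Tt' : T (endpoint (rcons u j) - e j, [set j; m]%SET).
  by rewrite endpoint_rcons addrK.
have [_ mk] := left_tiles_eq v_fan tT jm Tt' lt T'.
by exists u, j, k, z; split; rewrite // -mk.
Qed.

Lemma ascent_below u j z m : w = u ++ j :: z -> (m < j)%N ->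
  T (endpoint u - e m, [set m; j]%SET) -> has_tiled_ascent w.
Proof.
elim/last_ind: u z j m => [|u k IH] z j m wE mj Tt.
  case: (tiling_box tT Tt m) => /=.
  by rewrite coord_sub_basis endpoint_coord eqxx /=; lia.
have wE' : w = u ++ k :: j :: z by rewrite wE cat_rcons.
have [njm nmj] := ord_lt_neq mj.
have free : left_free a (endpoint u) k.
  have [mk|km] := ltnP m k; [right; exists m|left; exists j]; split=> //.
  - have [_ km] := ord_lt_neq mk; case: (tiling_box tT Tt m) => /= + _.
    rewrite coord_sub_basis eqxx endpoint_rcons coord_add_basis.
    by rewrite (ord_lt_neq mk).1; lia.
  - exact: leq_ltn_trans mj.
  - case: (tiling_box tT Tt j) => /= _.
    rewrite coord_sub_basis nmj endpoint_rcons coord_add_basis !inE eqxx orbT.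
    by case: (j == k) => /=; lia.
case: (left_tile v_fan tT (edge wE') free) => -[m' [lt T']]; last exact: IH wE' lt T'.
have T'' : T (endpoint (rcons u k) - e k, [set k; m']%SET).
  by rewrite endpoint_rcons addrK.
have [km m'j] := left_tiles_eq v_fan tT lt T'' mj Tt.
by exists u, k, j, z; split; rewrite // -m'j.
Qed.

Lemma tiled_ascent : ~~ sorted >=%O w -> has_tiled_ascent w.
Proof.
move=> /not_sorted_ascent[u [j [k [z [wE jk _]]]]]; have [_ kj] := ord_lt_neq jk.
have free : left_free a (endpoint u) j.
  left; exists k; split=> //.
  by have := full_count k fw wE; rewrite endpoint_coord kj /= eqxx; lia.
case: (left_tile v_fan tT (edge wE) free) => -[m [lt T']].
  exact: ascent_above wE lt T'.
exact: ascent_below wE lt T'.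
Qed.

End Ascents.

Section RightBoundary.
Variables (R : realType) (n : nat) (a : 'I_n -> nat) (theta : 'I_n -> R).
Hypothesis v_fan : fan (abscissa theta) (ordinate theta).
Implicit Types (i j k : 'I_n) (u w z : seq 'I_n) (T : set (cell n)).

Definition right_word : seq 'I_n := sort <=%O (word_with_counts a).

Lemma full_right_word : full a right_word.
Proof. by move=> i; rewrite count_sort count_word_with_counts. Qed.

Lemma sorted_right_word : sorted <=%O right_word.
Proof. exact: sort_le_sorted. Qed.

Lemma right_word_split u z i k :
  right_word = u ++ z -> i \in u -> k \in z -> (i <= k)%N.
Proof.
have := sorted_right_word; rewrite (sorted_pairwise le_trans) => + wE.
by rewrite wE pairwise_cat => /and3P[/allrelP/(_ i k)].
Qed.

Lemma right_edge_unique u j z r : right_word = u ++ j :: z -> @box R n a r ->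
  same_proj (abscissa theta) (ordinate theta) r (center R (endpoint u, [set j]%SET)) ->
  r = center R (endpoint u, [set j]%SET).
Proof.
move=> wE rbox [rx ry]; set q := center R _.
have count i := full_count i full_right_word wE.
have qE i : i != j -> q ord0 i = (count_mem i u)%:R.
  by move=> ij; rewrite mxE /= inE (negbTE ij) endpoint_coord mul0r addr0.
have [||_ ->] // := @extremal_point R n _ _ v_fan q r j _ _ ry.
- move=> i ij; have [nij _] := ord_lt_neq ij; rewrite qE ?nij //.
  have iz : i \notin z.
    apply/negP => iz; have := @right_word_split (rcons u j) z j i.
    by rewrite cat_rcons mem_rcons mem_head leqNgt ij => /(_ wE isT iz).
  by have /andP[_] := rbox i; rewrite count nij (count_memPn iz) !addn0.
- move=> i ji; have [_ nij] := ord_lt_neq ji; rewrite qE ?nij //.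
  have iu : i \notin u.
    apply/negP => iu; have := @right_word_split u (j :: z) i j wE iu (mem_head _ _).
    by rewrite leqNgt ji.
  by rewrite (count_memPn iu); case/andP: (rbox i).
Qed.

Lemma right_path_in T : tiling a theta T -> path_in T 0 right_word.
Proof.
move=> tT; apply/path_inP => u j z wE.
have ebox : in_box a (endpoint u, [set j]%SET).
  move=> i; rewrite /= endpoint_coord inE (full_count i full_right_word wE).
  by split=> //; case: (i == j) => /=; lia.
have [r [rr rq]] :=
  tiling_surj tT (in_box_points ebox (center_points R (endpoint u, [set j]%SET))).
have rbox : @box R n a r.
  by case: rr => c [/(tiling_box tT) bc rc]; exact: in_box_points rc.
have := rr; rewrite (right_edge_unique wE rbox rq).
by move=> /(realization_carrier _ (tiling_closed tT)); rewrite center_carrier.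
Qed.

End RightBoundary.

(** * Sweeps *)

Section PathAbscissa.
Variables (R : realFieldType) (n : nat) (vx vy : 'I_n -> R).
Hypothesis v_fan : fan vx vy.
Implicit Types (i j k : 'I_n) (u w z : seq 'I_n) (h x y : R).

Let vy_gt0 i : 0 < vy i. Proof. exact: fan_vy_gt0 v_fan i. Qed.

(* The abscissa at height h of the polygonal path from the origin with steps
   (vx j, vy j), for j in w. *)
Fixpoint path_abscissa w h : R :=
  if w is j :: w' then
    if h <= vy j then h * (vx j / vy j) else vx j + path_abscissa w' (h - vy j)
  else 0.

Lemma path_abscissa0 w : path_abscissa w 0 = 0.
Proof. by case: w => //= j w; rewrite ltW ?mul0r. Qed.

Lemma path_abscissa_cons j w h : vy j <= h ->
  path_abscissa (j :: w) h = vx j + path_abscissa w (h - vy j).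
Proof.
move=> /= jh; case: ifP => // hj; have -> : h = vy j by apply/eqP; rewrite eq_le jh hj.
by rewrite subrr path_abscissa0 addr0 mulrC divfK // gt_eqF.
Qed.

Lemma path_height_ge0 u : 0 <= \sum_(i <- u) vy i.
Proof. by apply: sumr_ge0 => j _; exact: ltW. Qed.

Lemma path_abscissa_cat u w h : 0 <= h ->
  path_abscissa (u ++ w) (\sum_(i <- u) vy i + h) =
    \sum_(i <- u) vx i + path_abscissa w h.
Proof.
move=> h0; elim: u => [|j u IH]; first by rewrite !big_nil !add0r.
rewrite cat_cons path_abscissa_cons !big_cons; last first.
  by rewrite -addrA lerDl addr_ge0 // path_height_ge0.
have -> : vy j + \sum_(i <- u) vy i + h - vy j = \sum_(i <- u) vy i + h by ring.
by rewrite IH addrA.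
Qed.

Lemma path_abscissa_vertex u w :
  path_abscissa (u ++ w) (\sum_(i <- u) vy i) = \sum_(i <- u) vx i.
Proof.
by rewrite -[\sum_(i <- u) vy i]addr0 path_abscissa_cat // path_abscissa0 addr0.
Qed.

Definition slope j := vx j / vy j.

Lemma slopeK j : slope j * vy j = vx j.
Proof. by rewrite /slope divfK // gt_eqF. Qed.

Lemma slope_lt j k : (j < k)%N -> slope k < slope j.
Proof.
move=> /(fan_cross_gt0 v_fan); rewrite /cross subr_gt0 => lt.
by rewrite /slope ltr_pdivrMr // mulrAC ltr_pdivlMr // mulrC.
Qed.

Lemma path_abscissa2 j k z h : h <= vy j + vy k ->
  path_abscissa (j :: k :: z) h = h * slope k + Num.min h (vy j) * (slope j - slope k).
Proof.
move=> hjk /=; case: ifP => hj; first by rewrite min_l // -/(slope j); ring.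
rewrite min_r; last by rewrite ltW // ltNge hj.
have -> : h - vy j <= vy k by lra.
by rewrite -/(slope k) -(slopeK j); ring.
Qed.

Lemma path_abscissa_swap_above j k z h : vy j + vy k <= h ->
  path_abscissa (j :: k :: z) h = path_abscissa (k :: j :: z) h.
Proof.
move=> jkh; have vj := vy_gt0 j; have vk := vy_gt0 k.
do 4?[rewrite path_abscissa_cons; last lra].
by rewrite addrCA addrAC.
Qed.

Let min_add_ge h x y : h <= x + y -> 0 <= x -> 0 <= y -> 0 <= h ->
  h - Num.min h y <= Num.min h x.
Proof. by move=> hxy x0 y0 h0; rewrite lerBlDr; case: (leP h x) => hx;
  case: (leP h y) => hy; lra. Qed.

Lemma path_abscissa_swap_le u j k z h : (j < k)%N -> 0 <= h ->
  path_abscissa (u ++ k :: j :: z) h <= path_abscissa (u ++ j :: k :: z) h.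
Proof.
move=> jk; elim: u h => [|i u IH] h h0; last first.
  by rewrite /=; case: (leP h (vy i)) => // hi; rewrite lerD2l IH // subr_ge0 ltW.
have [hle|/ltW hgt] := leP h (vy j + vy k);
  last by rewrite !cat0s (path_abscissa_swap_above z hgt).
rewrite !cat0s !path_abscissa2 //; last by rewrite addrC.
have -> : h * slope j + Num.min h (vy k) * (slope k - slope j) =
  h * slope k + (h - Num.min h (vy k)) * (slope j - slope k) by ring.
rewrite lerD2l ler_wpM2r ?subr_ge0 ?(ltW (slope_lt jk)) //.
by apply: min_add_ge; rewrite // ltW.
Qed.

Lemma path_abscissa_gt j k z : (j < k)%N -> vx k < path_abscissa (j :: k :: z) (vy k).
Proof.
move=> jk; rewrite path_abscissa2 ?lerDr ?ltW // mulrC slopeK ltrDl.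
by rewrite mulr_gt0 ?subr_gt0 ?slope_lt //; case: (leP (vy k) (vy j)).
Qed.

Lemma path_abscissa_le j k z : (j < k)%N -> path_abscissa (k :: j :: z) (vy j) <= vx j.
Proof.
move=> jk; apply: le_trans (path_abscissa_swap_le [::] z jk (ltW (vy_gt0 j))) _.
by rewrite cat0s path_abscissa_cons // subrr path_abscissa0 addr0.
Qed.

Lemma parallelogram_between j k z h x : (j < k)%N -> 0 <= h ->
  path_abscissa (k :: j :: z) h < x <= path_abscissa (j :: k :: z) h ->
  exists al be, [/\ 0 <= al <= 1, 0 <= be <= 1,
    x = al * vx j + be * vx k & h = al * vy j + be * vy k].
Proof.
move=> jk h0; have vj := vy_gt0 j; have vk := vy_gt0 k.
have [hle|/ltW hgt] := leP h (vy j + vy k); last first.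
  rewrite (path_abscissa_swap_above z hgt) => /andP[/lt_le_trans/[apply]].
  by rewrite ltxx.
rewrite !path_abscissa2 //; last by rewrite addrC.
have -> : h * slope j + Num.min h (vy k) * (slope k - slope j) =
  h * slope k + (h - Num.min h (vy k)) * (slope j - slope k) by ring.
have dslope : 0 < slope j - slope k by rewrite subr_gt0 slope_lt.
(* y is the part of the height that is travelled along j *)
move=> /andP[x1 x2]; pose y := (x - h * slope k) / (slope j - slope k).
have yE : y * (slope j - slope k) = x - h * slope k by rewrite /y divfK // gt_eqF.
have y1 : h - Num.min h (vy k) <= y by rewrite -(ler_pM2r dslope) yE; lra.
have y2 : y <= Num.min h (vy j) by rewrite -(ler_pM2r dslope) yE; lra.
have [m1 m2] : Num.min h (vy j) <= vy j /\ Num.min h (vy k) <= vy k.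
  by rewrite !ge_min !lexx !orbT.
have [m3 m4] : Num.min h (vy j) <= h /\ Num.min h (vy k) <= h by rewrite !ge_min !lexx.
exists (y / vy j), ((h - y) / vy k); split.
- by apply/andP; split; [apply: divr_ge0; lra|rewrite ler_pdivrMr // mul1r; lra].
- by apply/andP; split; [apply: divr_ge0; lra|rewrite ler_pdivrMr // mul1r; lra].
- have -> : y / vy j * vx j = y * slope j by rewrite /slope; ring.
  have -> : (h - y) / vy k * vx k = (h - y) * slope k by rewrite /slope; ring.
  by lra.
- by rewrite !divfK ?gt_eqF //; ring.
Qed.

Lemma tile_between u j k z h x : (j < k)%N -> 0 <= h ->
  path_abscissa (u ++ k :: j :: z) h < x <= path_abscissa (u ++ j :: k :: z) h ->
  exists al be, [/\ 0 <= al <= 1, 0 <= be <= 1,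
    x = \sum_(i <- u) vx i + (al * vx j + be * vx k) &
    h = \sum_(i <- u) vy i + (al * vy j + be * vy k)].
Proof.
move=> jk; elim: u h x => [|i u IH] h x h0.
  move=> /(parallelogram_between jk h0)[al [be [al1 be1 xE hE]]].
  by exists al, be; rewrite !big_nil !add0r.
rewrite !cat_cons /=; case: (leP h (vy i)) => hi.
  by move=> /andP[/lt_le_trans/[apply]]; rewrite ltxx.
move=> xb; have [||al [be [al1 be1 xE hE]]] := IH (h - vy i) (x - vx i).
- by rewrite subr_ge0 ltW.
- by rewrite ltrBrDl lerBlDl.
by exists al, be; split; rewrite // big_cons -addrA -?xE -?hE addrC subrK.
Qed.

(* Along a sorted path the letters before the current one have been used
   completely and those after it not at all. *)
Lemma sorted_path_point (le : rel 'I_n) w h : reflexive le -> transitive le ->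
  sorted le w -> (0 < size w)%N -> 0 <= h <= \sum_(i <- w) vy i ->
  exists r j, [/\ j \in w, lin vy r = h, lin vx r = path_abscissa w h,
    forall i, ~~ le j i -> r ord0 i = (count_mem i w)%:R &
    forall i, ~~ le i j -> r ord0 i = 0].
Proof.
move=> le_refl le_tr; elim: w h => // j w IH h /= sw _ /andP[h0 hw];
  have vj := vy_gt0 j.
have := sw; rewrite path_sortedE // => /andP[/allP jw sw'].
case: leP => hj.
  exists ((h / vy j) *: delta_mx ord0 j), j; split;
    rewrite ?mem_head ?linearZ /= ?lin_delta //.
  - by rewrite divfK // gt_eqF.
  - by rewrite mulrAC mulrA.
  - move=> i ji; rewrite !mxE eqxx /=; have [ij|ij] := eqVneq i j;
      first by rewrite ij le_refl in ji.
    have iw : i \notin w by apply: contra ji => /jw.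
    by rewrite mulr0 (count_memPn iw).
  - move=> i ji; rewrite !mxE eqxx /=; have [ij|ij] := eqVneq i j; rewrite ?mulr0 //.
    by rewrite ij le_refl in ji.
rewrite big_cons in hw.
have [||r [j' [j'w ry rx r1 r0]]] := IH (h - vy j) sw'.
- by case: w hw {IH sw jw sw'} => //; rewrite big_nil; lra.
- by apply/andP; split; lra.
exists (delta_mx ord0 j + r), j'; split;
  rewrite ?inE ?j'w ?orbT // ?linearD /= ?lin_delta ?ry ?rx //.
- by rewrite addrC subrK.
- by move=> i ji; rewrite !mxE eqxx /= (r1 i ji) natrD eq_sym.
- move=> i ij'; rewrite !mxE eqxx /= (r0 i ij') addr0.
  by case: eqP => // ij; move: ij'; rewrite ij jw.
Qed.

End PathAbscissa.

Section Sweeps.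
Variable n : nat.
Implicit Types (j k : 'I_n) (u w z : seq 'I_n) (L : set (cell n)).
Local Notation e := (@basis_vec n).

(* L is the set of tiles passed over when the path with word w is pushed
   leftwards, one tile at a time, as far as possible. *)
Inductive sweep : seq 'I_n -> set (cell n) -> Prop :=
| sweep_nil w of sorted >=%O w : sweep w set0
| sweep_cons u j k z L of (j < k)%N & sweep (u ++ k :: j :: z) L :
    sweep (u ++ j :: k :: z) ([set (endpoint u, [set j; k]%SET)] `|` L).

Fixpoint noninversions w : nat :=
  if w is j :: w' then
    (count (fun i : 'I_n => j < i)%N w' + noninversions w')%N
  else 0%N.

Lemma noninversions_swap u j k z : (j < k)%N ->
  noninversions (u ++ j :: k :: z) = (noninversions (u ++ k :: j :: z)).+1.
Proof.
move=> jk; elim: u => [|i u IH] /=; last by rewrite IH !count_cat /=; lia.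
by rewrite jk ltnNge (ltnW jk) /=; lia.
Qed.

Lemma sweep_exists (P : seq 'I_n -> Prop) (Q : set (cell n)) :
  (forall w, P w -> ~~ sorted >=%O w -> exists u j k z,
     [/\ w = u ++ j :: k :: z, (j < k)%N, Q (endpoint u, [set j; k]%SET) &
         P (u ++ k :: j :: z)]) ->
  forall w, P w -> exists2 L, sweep w L & L `<=` Q.
Proof.
move=> next w; have [N] := ubnP (noninversions w).
elim: N w => // N IH w; rewrite ltnS => leN Pw.
have [sw|nsw] := boolP (sorted >=%O w); first by exists set0 => //; constructor.
have [u [j [k [z [wE jk Qt Pw']]]]] := next w Pw nsw.
have [|L sL LQ] := IH (u ++ k :: j :: z) _ Pw'.
  by rewrite -(noninversions_swap _ _ jk) -wE.
exists ([set (endpoint u, [set j; k]%SET)] `|` L); first by rewrite wE; constructor.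
by move=> c [->|/LQ].
Qed.

Lemma sweep_total w : exists L, sweep w L.
Proof.
have [w' _ /not_sorted_ascent[u [j [k [z [wE jk _]]]]]|L sL _] :=
  @sweep_exists (fun=> True) setT _ w I; last by exists L.
by exists u, j, k, z.
Qed.

End Sweeps.

Section SweepCover.
Variables (R : realType) (n : nat) (a : 'I_n -> nat) (vx vy : 'I_n -> R).
Hypothesis v_fan : fan vx vy.
Implicit Types (p q r : 'rV[R]_n) (V : 'rV[int]_n) (T L : set (cell n)).
Implicit Types (i j k : 'I_n) (u w z : seq 'I_n) (h : R) (f : 'I_n -> R).
Local Notation e := (@basis_vec n).
Local Notation E i := (delta_mx ord0 i : 'rV[R]_n).
Local Notation intv := (map_mx (intr : int -> R)).
Local Notation path_abscissa := (path_abscissa vx vy).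

Let vy_gt0 i : 0 < vy i. Proof. exact: fan_vy_gt0 v_fan i. Qed.

Lemma lin_add_basis f V j : lin f (intv (V + e j)) = lin f (intv V) + f j.
Proof. by rewrite map_mxD /basis_vec map_delta_mx linearD /= lin_delta. Qed.

Lemma lin_endpoint f u : lin f (intv (endpoint u)) = \sum_(i <- u) f i.
Proof.
elim/last_ind: u => [|u j IH]; first by rewrite endpoint_nil map_mx0 linear0 big_nil.
by rewrite endpoint_rcons lin_add_basis IH -cats1 big_cat big_seq1.
Qed.

Lemma path_point T V w h : path_in T V w -> (0 < size w)%N ->
  0 <= h <= \sum_(i <- w) vy i ->
  exists q, [/\ @realization R n T q, lin vx q = lin vx (intv V) + path_abscissa w h &
                lin vy q = lin vy (intv V) + h].
Proof.
elim: w V h => // j w IH V h [Tj wT] _ /andP[h0 hw]; have vj := vy_gt0 j.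
rewrite /=; case: leP => hj.
  exists (intv V + (h / vy j) *: E j); split.
  - exists (V, [set j]%SET); split=> //; apply/cell_pointsP => i.
    rewrite !mxE eqxx /= inE.
    have /andP[h1 h2] : 0 <= h / vy j <= 1.
      by rewrite divr_ge0 //= ?(ltW vj) // ler_pdivrMr // mul1r.
    case: (i == j) => /=; last by rewrite mulr0 !addr0 lexx.
    by apply/andP; split; lra.
  - by rewrite linearD linearZ /= lin_delta mulrAC mulrA.
  - by rewrite linearD linearZ /= lin_delta divfK // gt_eqF.
rewrite big_cons in hw.
have [||q [rq qx qy]] := IH (V + e j) (h - vy j) wT.
- by case: w hw {IH wT} => //; rewrite big_nil; lra.
- by apply/andP; split; lra.
by exists q; split; rewrite // ?qx ?qy lin_add_basis; ring.
Qed.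

Lemma full_height w : full a w -> \sum_(i <- w) vy i = \sum_i (a i)%:R * vy i.
Proof.
by move=> fw; rewrite -lin_endpoint; apply: eq_bigr => i _;
  rewrite mxE endpoint_coord fw.
Qed.

Lemma box_height w p : full a w -> @box R n a p -> 0 <= lin vy p <= \sum_(i <- w) vy i.
Proof.
move=> fw bp; rewrite (full_height fw); apply/andP; split.
  by apply: sumr_ge0 => i _; case/andP: (bp i) => p0 _; rewrite mulr_ge0 // ltW.
by apply: ler_sum => i _; case/andP: (bp i) => _ p1; rewrite ler_wpM2r // ltW.
Qed.

Lemma box_le_right_path w p : full a w -> (0 < size w)%N -> sorted <=%O w ->
  @box R n a p -> lin vx p <= path_abscissa w (lin vy p).
Proof.
move=> fw w0 sw bp.
have [r [j [_ ry <- r1 r0]]] :=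
  sorted_path_point v_fan lexx le_trans sw w0 (box_height fw bp).
have [|||//] := @extremal_point R n vx vy v_fan r p j; last by rewrite ry.
- by move=> i ij; rewrite r1 ?fw; [case/andP: (bp i)|rewrite -ltNge].
- by move=> i ij; rewrite r0; [case/andP: (bp i)|rewrite -ltNge].
Qed.

Lemma box_ge_left_path w p : full a w -> (0 < size w)%N -> sorted >=%O w ->
  @box R n a p -> path_abscissa w (lin vy p) <= lin vx p.
Proof.
move=> fw w0 sw bp.
have [r [j [_ ry <- r1 r0]]] :=
  sorted_path_point v_fan (le := >=%O) lexx ge_trans sw w0 (box_height fw bp).
have [|||//] := @extremal_point R n vx vy v_fan p r j; last by rewrite ry.
- by move=> i ij; rewrite r0; [case/andP: (bp i)|rewrite -ltNge].
- by move=> i ij; rewrite r1 ?fw; [case/andP: (bp i)|rewrite -ltNge].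
Qed.

Lemma parallelogram_points V j k (al be : R) : j != k -> 0 <= al <= 1 -> 0 <= be <= 1 ->
  cell_points (V, [set j; k]%SET) (intv V + (al *: E j + be *: E k)).
Proof.
move=> jk /andP[al0 al1] /andP[be0 be1]; apply/cell_pointsP => i.
rewrite mxE coord2 !inE mxE; have [->|ij] := eqVneq i j.
  by rewrite (negbTE jk) /=; apply/andP; split; lra.
by have [->|ik] := eqVneq i k => /=; apply/andP; split; lra.
Qed.

Lemma sweep_cover w L T p : sweep w L -> full a w -> (0 < size w)%N ->
  face_closed T -> path_in T 0 w -> L `<=` T ->
  @box R n a p -> lin vx p <= path_abscissa w (lin vy p) ->
  exists q, @realization R n T q /\ same_proj vx vy q p.
Proof.
move=> sw fw w0 Tf + + bp;
  elim: sw fw w0 => {w L} [w sw|u j k z L jk _ IH] fw w0 pw LT le.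
  have [q [rq qx qy]] := path_point pw w0 (box_height fw bp).
  exists q; split=> //; rewrite /same_proj qx qy map_mx0 !linear0 !add0r; split=> //.
  by apply/eqP; rewrite eq_le le andbT; exact: box_ge_left_path.
have Tt : T (endpoint u, [set j; k]%SET) by apply: LT; left.
have [/negbT njk _] := ord_lt_neq jk.
have [le'|lt] := leP (lin vx p) (path_abscissa (u ++ k :: j :: z) (lin vy p)).
  apply: IH => //; first exact: full_swap.
  - by move: w0; rewrite !size_cat.
  - exact: path_in_swap.
  - by move=> c Lc; apply: LT; right.
have /andP[h0 _] := box_height fw bp.
have [|al [be [al1 be1 xE yE]]] :=
  tile_between v_fan jk h0 (x := lin vx p) (u := u) (z := z).
  by rewrite lt le.
exists (intv (endpoint u) + (al *: E j + be *: E k)); split.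
  by exists (endpoint u, [set j; k]%SET); split=> //; exact: parallelogram_points.
by split; rewrite linearD /= lin_endpoint lin2.
Qed.

End SweepCover.

(** * Connectivity by flips *)

Section TileVertices.
Variable n : nat.
Implicit Types (U V : 'rV[int]_n) (j k : 'I_n).
Local Notation e := (@basis_vec n).

Lemma edge_vertexP U V j : face_of (vertex U) (V, [set j]%SET) -> U = V \/ U = V + e j.
Proof.
move=> /vertex_faceP Uf; have [Uj|Uj] := eqVneq (U ord0 j) (V ord0 j); [left|right];
  apply: eq_from_coord => i; rewrite ?coord_add_basis; move: (Uf i) => /=; rewrite inE;
  by have [->|ij] := eqVneq i j => /=; move: Uj; lia.
Qed.

Lemma tile_vertexP U V j k : j != k -> face_of (vertex U) (V, [set j; k]%SET) ->
  [\/ U = V, U = V + e j, U = V + e k | U = V + e j + e k].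
Proof.
move=> /negbTE jk /vertex_faceP Uf.
have coordE (b b' : bool) : U ord0 j = V ord0 j + b%:Z -> U ord0 k = V ord0 k + b'%:Z ->
    forall i, U ord0 i = V ord0 i + (b && (i == j))%:Z + (b' && (i == k))%:Z.
  move=> Uj Uk i; move: (Uf i) => /=; rewrite !inE.
  have [->|ij] := eqVneq i j; first by rewrite jk andbF andbT addr0.
  by have [->|ik] := eqVneq i k; rewrite ?andbT ?andbF ?addr0 //=; lia.
have Uj := Uf j; rewrite /= !inE eqxx /= in Uj.
have Uk := Uf k; rewrite /= !inE eqxx orbT /= in Uk.
have [Ej|Ej] := eqVneq (U ord0 j) (V ord0 j);
  have [Ek|Ek] := eqVneq (U ord0 k) (V ord0 k).
- constructor 1; apply: eq_from_coord => i; rewrite (coordE false false) ?addr0 //.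
- constructor 3; apply: eq_from_coord => i;
    rewrite (coordE false true) ?coord_add_basis ?addr0 //; lia.
- constructor 2; apply: eq_from_coord => i;
    rewrite (coordE true false) ?coord_add_basis ?addr0 //; lia.
- constructor 4; apply: eq_from_coord => i;
    rewrite (coordE true true) ?coord_add_basis //; lia.
Qed.

Lemma ascents_cases (u z u' z' : seq 'I_n) j k j' k' :
  u ++ j :: k :: z = u' ++ j' :: k' :: z' ->
  [\/ [/\ u = u', j = j' & k = k'],
      [/\ u' = rcons u j, j' = k & z = k' :: z'],
      [/\ u = rcons u' j', j = k' & z' = k :: z] |
      exists x y, u' ++ k' :: j' :: z' = x ++ j :: k :: y /\ endpoint x = endpoint u].
Proof.
elim: u u' => [|i u IH] [|i' u'] /=.
- by move=> [-> -> ->]; constructor 1.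
- case=> <-; case: u' => [|i'' u''] /= [<- zE]; first by constructor 2; rewrite zE.
  by constructor 4; exists [::], (u'' ++ k' :: j' :: z').
- case=> ->; case: u {IH} => [|i'' u''] /= [-> zE]; first by constructor 3; rewrite zE.
  constructor 4; exists (k' :: j' :: u''), z; rewrite -zE; split=> //.
  by rewrite !endpoint_cons addrCA.
- case=> -> /IH[[-> -> ->]|[-> -> ->]|[-> -> ->]|[x [y [-> xE]]]].
  + by constructor 1.
  + by constructor 2.
  + by constructor 3.
  + by constructor 4; exists (i' :: x), y; rewrite !endpoint_cons xE.
Qed.

End TileVertices.

Section Connectivity.
Variables (R : realType) (n : nat) (a : 'I_n -> nat) (theta : 'I_n -> R).
Local Notation vx := (abscissa theta).
Local Notation vy := (ordinate theta).
Hypothesis v_fan : fan vx vy.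
Implicit Types (c d : cell n) (J U V v : 'rV[int]_n) (T L : set (cell n)).
Implicit Types (i j k l : 'I_n) (u w z : seq 'I_n).
Local Notation e := (@basis_vec n).
Local Notation intv := (map_mx (intr : int -> R)).
Local Notation path_abscissa := (path_abscissa vx vy).

Let vy_gt0 i : 0 < vy i. Proof. exact: fan_vy_gt0 v_fan i. Qed.

Lemma flip_fibre_direction J j k l v v' T T' : flip_in a J j k l v v' T T' ->
  exists kappa, fibre_direction vx vy (cube J j k l) v kappa.
Proof.
case=> jkl _ vv _; have [kappa kappa_fibre] := cube_fibre_direction v_fan J jkl.
case: vv => [[-> _]|[-> _]]; first by exists kappa.
by exists (- kappa); apply: fibre_direction_opposite kappa_fibre; exact: cube_opposite.
Qed.

Lemma flip_in_tiling J j k l v v' T T' : flip_in a J j k l v v' T T' ->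
  tiling a theta T -> tiling a theta T'.
Proof.
move=> fl tT; have op := flip_opposite fl.
have [kappa kappa_fibre] := flip_fibre_direction fl.
case: fl => jkl bx _ [sub ->].
exact: flip_tiling v_fan (card_cube J jkl) op kappa_fibre bx tT sub.
Qed.

Lemma flip_in_new J j k l v v' T T' : flip_in a J j k l v v' T T' ->
  tiling a theta T -> ~ T (vertex v').
Proof.
move=> fl tT; have op := flip_opposite fl.
have [kappa kappa_fibre] := flip_fibre_direction fl.
case: fl => jkl bx _ [sub _].
exact: opposite_vertex_notin (card_cube J jkl) op kappa_fibre tT sub.
Qed.

Definition flips T T' := exists m s, flip_sequence a theta T T' m s.

Lemma flips_tiling T T' : flips T T' -> tiling a theta T /\ tiling a theta T'.
Proof. by move=> [m [s [<- <- ts _]]]; split; exact: ts. Qed.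

Lemma flips_refl T : tiling a theta T -> flips T T.
Proof. by move=> tT; exists 0%N, (fun=> T); split. Qed.

Lemma flips_trans T1 T2 T3 : flips T1 T2 -> flips T2 T3 -> flips T1 T3.
Proof.
move=> [m1 [s1 [s10 s1m tl1 fl1]]] [m2 [s2 [s20 s2m tl2 fl2]]].
exists (m1 + m2)%N, (fun t => if (t <= m1)%N then s1 t else s2 (t - m1)%N); split=> //.
- case: ifP => [le|_]; last by rewrite addKn.
  have m20 : m2 = 0%N by lia.
  by rewrite m20 addn0 s1m -s20 -{1}m20.
- by move=> t tm; case: ifP => tm1; [exact: tl1|apply: tl2; lia].
- move=> t tm; case: (ltngtP t m1) => tm1.
  + exact: fl1.
  + by rewrite subSn ?(ltnW tm1) //; apply: fl2; lia.
  + by rewrite tm1 subSn // subnn s1m -s20; apply: fl2; lia.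
Qed.

Lemma flips_flip_in J j k l v v' T T' : tiling a theta T ->
  flip_in a J j k l v v' T T' -> flips T T'.
Proof.
move=> tT fl; exists 1%N, (fun t => if t is 0%N then T else T'); split=> //.
  by case=> [|[]] // _; exact: flip_in_tiling fl tT.
by case=> // _; exists J, j, k, l, v, v'.
Qed.

Definition right_of w c := forall U, face_of (vertex U) c ->
  path_abscissa w (lin vy (intv U)) <= lin vx (intv U).

Lemma right_of_edge u j z : right_of (u ++ j :: z) (endpoint u, [set j]%SET).
Proof.
move=> U /edge_vertexP[->|->]; first by rewrite !lin_endpoint path_abscissa_vertex.
rewrite -cat_rcons !lin_add_basis !lin_endpoint.
have := path_abscissa_vertex v_fan (rcons u j) z.
by rewrite -!cats1 !big_cat !big_seq1 => ->.
Qed.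

Lemma right_of_tile u j k z : (j < k)%N ->
  right_of (u ++ k :: j :: z) (endpoint u, [set j; k]%SET).
Proof.
move=> jk; have [/negbT njk _] := ord_lt_neq jk; have vj := vy_gt0 j;
  have vk := vy_gt0 k.
move=> U /(tile_vertexP njk)[->|->|->|->]; rewrite !(lin_add_basis, lin_endpoint).
- by rewrite path_abscissa_vertex.
- by rewrite path_abscissa_cat ?(ltW vj) // lerD2l path_abscissa_le.
- rewrite path_abscissa_cat ?(ltW vk) // lerD2l path_abscissa_cons //.
  by rewrite subrr (path_abscissa0 v_fan) addr0.
- have jk_ge0 : 0 <= vy j + vy k by rewrite addr_ge0 // ltW.
  have k_le : vy k <= vy j + vy k by rewrite lerDr ltW.
  rewrite -!addrA path_abscissa_cat // lerD2l path_abscissa_cons // addrK.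
  rewrite path_abscissa_cons //.
  by rewrite subrr (path_abscissa0 v_fan) addr0 addrC.
Qed.

Lemma right_of_swap u j k z c : (j < k)%N -> in_box a c ->
  right_of (u ++ j :: k :: z) c -> right_of (u ++ k :: j :: z) c.
Proof.
move=> jk bc rc U Uc; apply: le_trans (rc U Uc); apply: path_abscissa_swap_le => //.
apply: sumr_ge0 => i _; rewrite mxE mulr_ge0 ?ler0z ?(ltW (vy_gt0 i)) //.
by case: (in_box_face bc Uc i).
Qed.

Definition left_flips w T T' := flips T T' /\ forall c, T c -> right_of w c -> T' c.

Lemma left_flips_refl w T : tiling a theta T -> left_flips w T T.
Proof. by move=> tT; split=> //; exact: flips_refl. Qed.

Lemma left_flips_trans w T1 T2 T3 :
  left_flips w T1 T2 -> left_flips w T2 T3 -> left_flips w T1 T3.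
Proof.
move=> [f12 k12] [f23 k23]; split; first exact: flips_trans f23.
by move=> c T1c rc; apply: (k23 _ _ rc); exact: k12.
Qed.

Lemma left_flips_swap u j k z T T' : (j < k)%N ->
  left_flips (u ++ k :: j :: z) T T' -> left_flips (u ++ j :: k :: z) T T'.
Proof.
move=> jk [fTT' kept]; split=> // c Tc rc; apply: kept => //.
by apply: right_of_swap => //; exact: tiling_box (flips_tiling fTT').1 _ Tc.
Qed.

Lemma left_flips_path w T T' : left_flips w T T' -> path_in T 0 w -> path_in T' 0 w.
Proof.
move=> [_ kept] /path_inP pw; apply/path_inP => u j z wE.
by apply: kept; [exact: pw wE|rewrite wE; exact: right_of_edge].
Qed.

Section Hexagon.
Variables (u z : seq 'I_n) (j k l : 'I_n) (T : set (cell n)).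
Hypothesis jkl : (j < k < l)%N.
Hypothesis fw : full a (u ++ j :: k :: l :: z).
Hypothesis tT : tiling a theta T.
Local Notation J := (endpoint u).
Local Notation w := (u ++ j :: k :: l :: z).

Lemma word_cube_box : in_box a (cube J j k l).
Proof.
move=> i; have := fw i; have := mem_cubeE J jkl i;
  rewrite /= endpoint_coord count_cat /=.
by rewrite ![_ == i]eq_sym; case: (i \in _); lia.
Qed.

Lemma hexagon_vertex_left v :
  v = bottom_vertex J j k l \/ v = top_vertex J j k l ->
  lin vx (intv v) < path_abscissa w (lin vy (intv v)).
Proof.
have /andP[jk kl] := jkl; have vj := vy_gt0 j; have vk := vy_gt0 k; have vl := vy_gt0 l.
case=> ->; rewrite /bottom_vertex /top_vertex !(lin_add_basis, lin_endpoint).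
  by rewrite path_abscissa_cat ?ltrD2l ?path_abscissa_gt // ltW.
rewrite -!addrA path_abscissa_cat ?addr_ge0 ?ltW // ltrD2l.
rewrite path_abscissa_cons ?lerDl ?ltW //.
by rewrite [vy j + _]addrC addrK ltrD2l path_abscissa_gt.
Qed.

Lemma hexagon_flip v v' :
  (v = bottom_vertex J j k l /\ v' = top_vertex J j k l) \/
  (v = top_vertex J j k l /\ v' = bottom_vertex J j k l) ->
  faces_at (cube J j k l) v `<=` T ->
  exists2 T', left_flips w T T' & faces_at (cube J j k l) v' `<=` T'.
Proof.
pose c := cube J j k l; move=> vv sub.
pose T' := (T `\` faces_at c v) `|` faces_at c v'.
have fl : flip_in a J j k l v v' T T' by split=> //; exact: word_cube_box.
exists T'; last by move=> d fd; right.
split=> [|d Td rd]; first exact: flips_flip_in fl.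
apply: (flip_kept (card_cube J jkl) (flip_opposite fl)) => // /rd; apply/negP;
  rewrite -ltNge.
by apply: hexagon_vertex_left; case: vv => -[-> _]; [left|right].
Qed.

End Hexagon.

Definition sweepable w := forall T L, tiling a theta T -> path_in T 0 w -> sweep w L ->
  exists2 T', left_flips w T T' & L `<=` T'.

(* The tile over the ascent j k of w = u j k z can be prescribed once the words
   obtained from w by resolving one ascent are sweepable: w has some ascent with
   a tile of T over it; far apart ascents commute and adjacent ones span a
   hexagon, in which a flip is made. *)
Section PrescribedTile.
Variables (w : seq 'I_n) (T : set (cell n)).
Hypothesis fw : full a w.
Hypothesis tT : tiling a theta T.
Hypothesis pw : path_in T 0 w.
Hypothesis swap_sweepable : forall u j k z, w = u ++ j :: k :: z -> (j < k)%N ->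
  sweepable (u ++ k :: j :: z).

Lemma sweep_over_tile u j k z L : w = u ++ j :: k :: z -> (j < k)%N ->
  T (endpoint u, [set j; k]%SET) -> sweep (u ++ k :: j :: z) L ->
  exists T', [/\ left_flips w T T', L `<=` T' & T' (endpoint u, [set j; k]%SET)].
Proof.
move=> wE jk Tt sL; have [njk _] := ord_lt_neq jk.
have [|T' fT' LT'] := swap_sweepable wE jk tT _ sL.
  by apply: path_in_swap; rewrite ?njk -?wE //; exact: tiling_closed tT.
exists T'; split=> //; first by rewrite wE; exact: left_flips_swap.
by case: fT' => _ kept; apply: kept => //; exact: right_of_tile.
Qed.

Lemma bottom_tile_prescribed u j k l z : w = u ++ j :: k :: l :: z -> (j < k < l)%N ->
  T (endpoint u + e j, [set k; l]%SET) ->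
  exists2 T', left_flips w T T' & T' (endpoint u, [set j; k]%SET).
Proof.
move=> wE jkl Tkl; have /andP[jk kl] := jkl; have jl := ltn_trans jk kl.
have [L sL] := sweep_total (u ++ l :: k :: j :: z).
have {}sL : sweep (u ++ j :: l :: k :: z) ([set (endpoint u, [set j; l]%SET)] `|`
    ([set (endpoint (rcons u l), [set j; k]%SET)] `|` L)).
  by constructor=> //; rewrite -cat_rcons; constructor; rewrite // cat_rcons.
rewrite -cat_rcons in sL; rewrite -endpoint_rcons in Tkl.
have [|T2 [fT2 LT2 T2kl]] := sweep_over_tile _ kl Tkl sL; first by rewrite cat_rcons.
have tT2 := (flips_tiling fT2.1).2.
have fw' : full a (u ++ j :: k :: l :: z) by rewrite -wE.
have [||T3 fT3 T3sub] := hexagon_flip jkl fw' tT2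
    (v := top_vertex (endpoint u) j k l) (v' := bottom_vertex (endpoint u) j k l).
- by right.
- apply: top_faces_sub => //; first exact: tiling_closed tT2.
  + by rewrite -endpoint_rcons.
  + by apply: LT2; left.
  + by apply: LT2; right; left; rewrite endpoint_rcons.
exists T3; last exact/T3sub/bottom_tile.
by apply: left_flips_trans fT2 _; rewrite wE.
Qed.

Lemma top_tile_prescribed u j k l z : w = u ++ j :: k :: l :: z -> (j < k < l)%N ->
  T (endpoint u, [set j; k]%SET) ->
  exists2 T', left_flips w T T' & T' (endpoint u + e j, [set k; l]%SET).
Proof.
move=> wE jkl Tjk; have /andP[jk kl] := jkl; have jl := ltn_trans jk kl.
have [L sL] := sweep_total (u ++ l :: k :: j :: z).
have {}sL : sweep (u ++ k :: j :: l :: z)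
    ([set (endpoint (rcons u k), [set j; l]%SET)] `|`
    ([set (endpoint u, [set k; l]%SET)] `|` L)).
  by rewrite -cat_rcons; constructor; rewrite // cat_rcons; constructor.
have [T2 [fT2 LT2 T2jk]] := sweep_over_tile wE jk Tjk sL.
have tT2 := (flips_tiling fT2.1).2.
have fw' : full a (u ++ j :: k :: l :: z) by rewrite -wE.
have [||T3 fT3 T3sub] := hexagon_flip jkl fw' tT2
    (v := bottom_vertex (endpoint u) j k l) (v' := top_vertex (endpoint u) j k l).
- by left.
- apply: bottom_faces_sub => //; first exact: tiling_closed tT2.
  + by apply: LT2; right; left.
  + by apply: LT2; left; rewrite endpoint_rcons.
exists T3; last exact/T3sub/top_tile.
by apply: left_flips_trans fT2 _; rewrite wE.
Qed.

Lemma tile_prescribed u j k z : w = u ++ j :: k :: z -> (j < k)%N ->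
  exists2 T', left_flips w T T' & T' (endpoint u, [set j; k]%SET).
Proof.
move=> wE jk.
have nsw : ~~ sorted >=%O w.
  apply/negP; rewrite wE (sorted_pairwise ge_trans) pairwise_cat => /and3P[_ _].
  by rewrite /= leEord leqNgt jk.
have [u' [j' [k' [z' [wE' jk' Tt]]]]] := tiled_ascent v_fan tT fw pw nsw.
have := wE'; rewrite {1}wE => /ascents_cases.
case=> [[-> -> ->]|[uE jE zE]|[uE jE zE]|[x [y [xE xu]]]].
- by exists T => //; exact: left_flips_refl.
- rewrite jE in jk' Tt; rewrite uE endpoint_rcons in Tt.
  by apply: (@bottom_tile_prescribed u j k k' z'); rewrite ?jk // wE zE.
- rewrite -jE in jk' Tt; rewrite uE endpoint_rcons.
  by apply: (@top_tile_prescribed u' j' j k z); rewrite ?jk' // wE uE cat_rcons.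
- have [L sL] := sweep_total (x ++ k :: j :: y).
  have [|T' [fT' LT' _]] := sweep_over_tile
    (L := [set (endpoint x, [set j; k]%SET)] `|` L) wE' jk' Tt.
    by rewrite xE; constructor.
  by exists T' => //; apply: LT'; left; rewrite xu.
Qed.

End PrescribedTile.

Lemma full_sweepable w : full a w -> sweepable w.
Proof.
have [N] := ubnP (noninversions w); elim: N w => // N IH w;
  rewrite ltnS => leN fw T L tT pw sw.
case: sw leN fw pw => {w L} [w _|u j k z L jk sL] leN fw pw.
  by exists T => //; exact: left_flips_refl.
have [njk _] := ord_lt_neq jk.
have [|T1 fT1 T1t] := tile_prescribed fw tT pw _ erefl jk.
  move=> u' j' k' z' wE jk'; apply: IH; last by apply: full_swap; rewrite -wE.
  by rewrite -(noninversions_swap _ _ jk') -wE.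
have tT1 := (flips_tiling fT1.1).2.
have pw1 : path_in T1 0 (u ++ k :: j :: z).
  apply: path_in_swap; rewrite ?njk //; first exact: tiling_closed tT1.
  exact: left_flips_path pw.
have [|T2 fT2 LT2] := IH _ _ (full_swap fw) T1 L tT1 pw1 sL.
  by rewrite -(noninversions_swap _ _ jk).
exists T2; first exact: left_flips_trans (left_flips_swap jk fT2).
by move=> c [->|/LT2//]; case: fT2 => _; apply=> //; exact: right_of_tile.
Qed.

End Connectivity.

(** * Tilings with interval vertices *)

Section IntervalCells.
Variables (n : nat) (a : 'I_n -> nat).
Implicit Types (U V : 'rV[int]_n) (c : cell n) (i j k l m : 'I_n) (u w z : seq 'I_n).
Local Notation e := (@basis_vec n).
Local Notation interval := (interval_form (fun=> 0 : int) (fun i => (a i)%:Z)).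

Definition interval_cells : set (cell n) :=
  [set c | forall U, face_of (vertex U) c -> interval U].

Lemma interval_cells_closed : face_closed interval_cells.
Proof. by move=> c d cI dc U Ud; apply: cI; exact: face_of_trans dc. Qed.

Lemma interval_right_prefix u z : right_word a = u ++ z -> interval (endpoint u).
Proof.
move=> wE i k l /andP[ik kl] _; rewrite !endpoint_coord => lu.
have {}lu : l \in u by rewrite -has_pred1 has_count; lia.
have kz : k \notin z.
  by apply/negP => kz; have := right_word_split wE lu kz; rewrite leqNgt kl.
by rewrite -(full_right_word a k) wE count_cat (count_memPn kz) addn0.
Qed.

Lemma right_path_interval : path_in interval_cells 0 (right_word a).
Proof.
apply/path_inP => u j z wE U /edge_vertexP[->|->];
  first exact: interval_right_prefix wE.
by rewrite -endpoint_rcons; apply: (@interval_right_prefix _ z); rewrite cat_rcons.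
Qed.

Lemma interval_leftmost_ascent V j k : (j < k)%N ->
  (forall i, 0 < V ord0 i -> (j <= i)%N) ->
  interval (V + e j + e k) -> interval (V + e k).
Proof.
move=> jk j_first iVjk i m l /andP[im ml] Vi Vl.
have ji : (j <= i)%N.
  move: Vi; rewrite coord_add_basis; have [-> _|_] := eqVneq i k; first exact: ltnW.
  by rewrite addr0; exact: j_first.
have := iVjk i m l; have [_ mj] := ord_lt_neq (leq_ltn_trans ji im).
rewrite im ml !coord_add_basis mj addr0; apply=> //.
  by move: Vi; rewrite coord_add_basis; case: (i == j); lia.
by move: Vl; rewrite coord_add_basis; case: (l == j); lia.
Qed.

(* Always resolving the leftmost ascent keeps every vertex of interval form. *)
Lemma interval_sweep : exists2 L, sweep (right_word a) L & L `<=` interval_cells.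
Proof.
apply: (sweep_exists (P := path_in interval_cells 0)) right_path_interval => w pw.
move=> /not_sorted_ascent[u [j [k [z [wE jk ju]]]]];
  have [/negbT njk _] := ord_lt_neq jk.
rewrite wE in pw; have [_] := (path_in_cat _ _ _ _).1 pw.
rewrite add0r => -[Vj [Vjk _]]; pose V := endpoint u.
have [iV iVj iVjk] : [/\ interval V, interval (V + e j) & interval (V + e j + e k)].
  split; [apply: Vj|apply: Vj|apply: Vjk]; apply/vertex_faceP => i;
    by rewrite /= inE ?coord_add_basis lexx lerDl.
have iVk : interval (V + e k).
  apply: interval_leftmost_ascent jk _ iVjk => i; rewrite endpoint_coord => ui.
  by apply: ju; rewrite -has_pred1 has_count; lia.
have tI : interval_cells (V, [set j; k]%SET) by move=> U /(tile_vertexP njk)[] ->.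
exists u, j, k, z; split=> //; exact: path_in_swap interval_cells_closed njk pw tI.
Qed.

End IntervalCells.

Section TilingsConnected.
Variables (R : realType) (n : nat) (a : 'I_n -> nat) (theta : 'I_n -> R).
Hypothesis v_fan : fan (abscissa theta) (ordinate theta).
Hypothesis word_gt0 : (0 < size (right_word a))%N.
Implicit Types (c d : cell n) (T L : set (cell n)) (w : seq 'I_n).

Lemma tiling_sweep T : tiling a theta T -> exists2 L, sweep (right_word a) L & L `<=` T.
Proof.
move=> tT; apply: (sweep_exists (P := fun w => full a w /\ path_in T 0 w)); last first.
  by split; [exact: full_right_word|exact: (right_path_in v_fan tT)].
move=> w [fw pw] /(tiled_ascent v_fan tT fw pw)[u [j [k [z [wE jk Tt]]]]].
rewrite wE in fw pw; have [/negbT njk _] := ord_lt_neq jk.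
exists u, j, k, z; split=> //; split; first exact: full_swap.
exact: path_in_swap (tiling_closed tT) njk pw Tt.
Qed.

(* The cells common to T and T' already cover the zonogon. *)
Lemma sweep_determines T T' L : tiling a theta T ->
  sweep (right_word a) L -> L `<=` T ->
  face_closed T' -> path_in T' 0 (right_word a) -> L `<=` T' -> T `<=` T'.
Proof.
move=> tT sL LT T'f /path_inP pT' LT' c Tc.
have Tf := tiling_closed tT; have /path_inP pT := right_path_in v_fan tT.
have common_closed : face_closed (T `&` T').
  by move=> d d' [Td T'd] d'd; split; [exact: Tf d'd|exact: T'f d'd].
have common_path : path_in (T `&` T') 0 (right_word a).
  by apply/path_inP => u j z wE; split; [exact: pT wE|exact: pT' wE].
have LTT' : L `<=` T `&` T' by move=> d Ld; split; [exact: LT|exact: LT'].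
have cbox := in_box_points (tiling_box tT Tc) (center_points R c).
have fw := @full_right_word n a.
have [q [[d [[Td T'd] qd]] qc]] := sweep_cover v_fan sL fw word_gt0 common_closed
  common_path LTT' cbox
  (box_le_right_path v_fan fw word_gt0 (sorted_right_word a) cbox).
have qE : q = center R c.
  apply: (tiling_inj tT) => //; first by exists d.
  by exists c; split=> //; exact: center_points.
by rewrite -[c](center_carrier R) -qE; apply: T'f T'd _; exact: carrier_face.
Qed.

Lemma flips_to_sweep T L : tiling a theta T -> sweep (right_word a) L ->
  exists2 T', flips a theta T T' & L `<=` T'.
Proof.
move=> tT sL; have [T' [fT' _] LT'] :=
  full_sweepable v_fan (@full_right_word n a) tT (right_path_in v_fan tT) sL.
by exists T'.
Qed.

Lemma tilings_connected T T' :
  tiling a theta T -> tiling a theta T' -> flips a theta T T'.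
Proof.
move=> tT tT'; have [L sL LT'] := tiling_sweep tT'.
have [T1 fT1 LT1] := flips_to_sweep tT sL; have [_ tT1] := flips_tiling fT1.
suff -> : T' = T1 by [].
apply/seteqP; split.
- exact: sweep_determines tT' sL LT' (tiling_closed tT1) (right_path_in v_fan tT1) LT1.
- exact: sweep_determines tT1 sL LT1 (tiling_closed tT') (right_path_in v_fan tT') LT'.
Qed.

Lemma flips_to_interval T : tiling a theta T ->
  exists2 T', flips a theta T T' & T' `<=` interval_cells a.
Proof.
move=> tT; have [L sL LI] := interval_sweep a.
have [T' fT' LT'] := flips_to_sweep tT sL; have [_ tT'] := flips_tiling fT'.
exists T' => //.
apply: sweep_determines tT' sL LT' _ (right_path_interval a) LI.
exact: interval_cells_closed.
Qed.

Local Notation zero := (fun=> 0 : int).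
Local Notation top := (fun i => (a i)%:Z).

Lemma values_extend (F : realFieldType) T (x : 'rV[int]_n -> F) : tiling a theta T ->
  (forall J, T (vertex J) -> 0 < x J) ->
  exists X, [/\ positive_on zero top X, cube_relations_on zero top X & agree_on X T x].
Proof.
move=> tT x_gt0; have [T1 [m [s [s0 sm ts fs]]] T1I] := flips_to_interval tT.
have tT1 : tiling a theta T1 by rewrite -sm; exact: ts.
have [|xs [vx xs_gt0]] := @values_along_exist F n a m s x fs; first by rewrite s0.
pose x0 K := if `[< T1 (vertex K) >] then xs m K else 1.
have [|X [X_gt0 X_cube Xx0]] := @cube_extension F n zero top x0.
  by move=> K; rewrite /x0; case: asboolP => [TK|_]; rewrite ?ltr01 // xs_gt0 // sm.
exists X; split=> //; rewrite -s0; apply: (values_along_solution_back X_gt0 X_cube vx).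
- by move=> i /ltnW/ts/tiling_closed.
- by move=> i im J j k l v w fl; apply: flip_in_new v_fan _ _ _ _ _ _ _ _ fl _;
    exact/ts/ltnW.
- move=> K; rewrite sm => T1K; rewrite Xx0; first by rewrite /x0; case: asboolP.
    by move=> i; case: (tiling_box tT1 T1K i) => /=; rewrite inE addr0 => -> ->.
  exact: T1I T1K _ (face_of_refl _).
Qed.

End TilingsConnected.

Theorem theorem2p2 (R : realType) (n : nat) (a : 'I_n -> nat)
    (theta : 'I_n -> R)
    (n_ge3 : (3 <= n)%N)
    (a_gt0 : forall i, (0 < a i)%N)
    (theta_bounds : forall i, 0 < theta i < pi)
    (theta_incr : forall i j : 'I_n, (i < j)%N -> theta i < theta j) :
  (forall T T' : set (cell n), tiling a theta T -> tiling a theta T' ->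
     exists (m : nat) (s : nat -> set (cell n)),
       flip_sequence a theta T T' m s)
  /\
  (forall (F : realFieldType) (T T' : set (cell n)) (x : 'rV[int]_n -> F),
     tiling a theta T -> tiling a theta T' ->
     (forall J, T (vertex J) -> 0 < x J) ->
     (forall (m : nat) (s : nat -> set (cell n)),
        flip_sequence a theta T T' m s ->
        exists xs : nat -> 'rV[int]_n -> F, values_along a m s x xs)
     /\
     (forall (m1 m2 : nat) (s1 s2 : nat -> set (cell n))
             (xs1 xs2 : nat -> 'rV[int]_n -> F),
        flip_sequence a theta T T' m1 s1 ->
        flip_sequence a theta T T' m2 s2 ->
        values_along a m1 s1 x xs1 ->
        values_along a m2 s2 x xs2 ->
        forall J, T' (vertex J) -> xs1 m1 J = xs2 m2 J)).
Proof.
have v_fan := angles_fan theta_bounds theta_incr.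
have word_gt0 : (0 < size (right_word a))%N.
  pose i : 'I_n := Ordinal (leq_trans (ltn0Sn 2) n_ge3).
  by apply: leq_trans (a_gt0 i) _; rewrite -(full_right_word a i) count_size.
split=> [T T' tT tT'|F T T' x tT tT' x_gt0]; first exact: tilings_connected.
split=> [m s [s0 sm ts fs]|].
  by have [|xs [vx _]] := @values_along_exist F n a m s x fs; [rewrite s0|exists xs].
have [X [X_gt0 X_cube xX]] := values_extend v_fan word_gt0 tT x_gt0.
move=> m1 m2 s1 s2 xs1 xs2 [s10 s1m _ _] [s20 s2m _ _] v1 v2 J TJ.
rewrite (values_along_solution X_gt0 X_cube v1) ?s10 ?s1m //.
by rewrite (values_along_solution X_gt0 X_cube v2) ?s20 ?s2m.
Qed.
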